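(* Let $s\ge 2$, let $\rho=(\rho_1,\dots,\rho_s)\in\,]0,1[^s$ with $\sum_{j=1}^s\rho_j=1$, and let $\gamma\in\,]0,1]$. In the setting and with the notation described in the context, assume that: (1) $\|K\|_\infty:=\sup_{(x,y)\in\mathcal X^2}K(x,y)<+\infty$; (2) for every $j\in\{1,\dots,s\}$, $\sqrt n\,(\pi_j-\rho_j)\to 0$ as $\min_{1\le j\le s}(n_j)\to+\infty$; (3) there exist a real number $\tau>0$ and an integer $n_0$ such that for all $r>n_0$: $\; r\left|\frac1r\sum_{i=1}^{r}k_{i,r}(\gamma)-1\right|\le\tau$; (4) there exists $c_k$ such that $\max_{1\le i\le r}k_{i,r}(\gamma')<c_k$ for all $r\in\mathbb N^\ast$ and all $\gamma'\in\,]0,1]$; (5) for every $\gamma'\in\,]0,1]$, $\lim_{r\to+\infty}\frac1r\sum_{i=1}^r k_{i,r}^2(\gamma')=k^2(\gamma')>1$ (where $k^2(\gamma')$ denotes the value of this limit). Then, as $\min_{1\le j\le s}(n_j)\to+\infty$, $$\sqrt n\,\big\{\widehat{\mathscr T}_{n,\gamma}-\mathscr T\big\}\ \longrightarrow\ \mathcal N(0,\sigma_\gamma^2)\quad\text{in distribution},$$ where $\sigma_\gamma^2=\sum_{j=1}^s4\rho_j^{-1}\sigma_j^2(\gamma)$ with $$\sigma_j^2(\gamma)=\mathrm{Var}\big(\mathcal U_j(X_1^{(j)})\big)+k^2(\gamma)\,\mathrm{Var}\big(\mathcal V_j(X_1^{(j)})\big)-2\,\mathrm{Cov}\big(\mathcal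 U_j(X_1^{(j)}),\mathcal V_j(X_1^{(j)})\big).$$
   Context: $\mathcal X$ is a metric space and $\mathcal H$ is a reproducing kernel Hilbert space of functions from $\mathcal X$ to $\mathbb R$ with reproducing kernel $K$, inner product $\langle\cdot,\cdot\rangle_{\mathcal H}$ and norm $\|\cdot\|_{\mathcal H}$. $\mathbb P_1,\dots,\mathbb P_s$ are probability distributions on $\mathcal X$. For each $j$, $X_1^{(j)},\dots,X_{n_j}^{(j)}$ is an i.i.d. sample from $\mathbb P_j$, and the $s$ samples are mutually independent. The kernel mean embedding of $\mathbb P_j$ is $m_j=\mathbb E\big(K(X_1^{(j)},\cdot)\big)\in\mathcal H$, i.e. $\langle m_j,f\rangle_{\mathcal H}=\mathbb E f(X_1^{(j)})$ for all $f\in\mathcal H$ (it exists since $K$ is bounded). Put $n=\sum_{j=1}^s n_j$, $\pi_j=n_j/n$. The asymptotic regime is that all sample sizes tend to infinity, $\min_j n_j\to+\infty$, with $\rho_j$ the (fixed) limiting proportions. The parameter is the squared generalized maximum mean discrepancy $$\mathscr T=\mathrm{GMMD}^2(\mathbb P_1,\dots,\mathbb P_s;\rho)=\sum_{j=1}^s\sum_{\ell=1,\,\ell\ne j}^s\rho_\ell\,\|m_j-m_\ell\|_{\mathcal H}^2 .$$ The weights $k_{i,r}(\gamma)$ ($r\in\mathbb N^\ast$, $1\le i\le r$, $\gamma\in\,]0,1]$) are positive real numbers. The estimator is $$\widehat{\mathscr T}_{n,\gamma}=\sum_{j=1}^s\sum_{\ell=1,\,\ell\ne j}^s\pi_\ell\Big\{\frac1{n_j^2}\sum_{i,p=1}^{n_j}K(X_i^{(j)},X_p^{(j)})+\frac1{n_\ell^2}\sum_{i,p=1}^{n_\ell}K(X_i^{(\ell)},X_p^{(\ell)})-\frac2{n_jn_\ell}\sum_{i=1}^{n_j}\sum_{p=1}^{n_\ell}k_{i,n_j}(\gamma)K(X_i^{(j)},X_p^{(\ell)})\Big\}.$$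 Put $m=\sum_{j=1}^s\rho_jm_j$ and $\mu=\sum_{j=1}^sm_j$. The functions $\mathcal U_j,\mathcal V_j:\mathcal X\to\mathbb R$ are $$\mathcal U_j(x)=\big\langle K(x,\cdot)-m_j,\ (1-2\rho_j+s\rho_j)m_j+\rho_j(m_j-\mu)\big\rangle_{\mathcal H},\qquad \mathcal V_j(x)=\big\langle K(x,\cdot)-m_j,\ m-\rho_jm_j\big\rangle_{\mathcal H}.$$ $\mathcal N(0,\sigma^2)$ is the centered normal law with variance $\sigma^2$ (the point mass at $0$ if $\sigma^2=0$). *)

(* Defs.v *)
From HB Require Import structures.
From mathcomp Require Import all_boot all_order all_algebra sesquilinear finmap.
From mathcomp Require Import all_classical all_reals all_analysis.

Set Implicit Arguments.
Unset Strict Implicit.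
Unset Printing Implicit Defensive.
Import Order.TTheory GRing.Theory Num.Theory.
Import numFieldNormedType.Exports.
Local Open Scope classical_set_scope.
Local Open Scope ring_scope.

(* Measurable types of the library are pointed, hence so are the metric spaces
   considered here. No generality is lost: a space carrying a probability
   measure is nonempty. *)
#[short(type="pmetricType")]
HB.structure Definition PMetric (K : numDomainType) :=
  {T of Metric K T & Pointed T}.

Definition borel (R : realType) (X : pmetricType R) : measurableType _ :=
  g_sigma_algebraType (@open X).

(* A real Hilbert space of functions on X: its elements are identified, via the
   injective linear map [rkhs_eval], with functions X -> R; [rkhs_feature x] is
   the element K(x, .) representing the evaluation at x. *)
Record rkhs (R : realType) (X : Type) := RKHS {
  rkhs_space :> completeNormedModType R ;
  rkhs_dot : {dot rkhs_space for (idfun : R -> R)} ;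
  rkhs_normE : forall f : rkhs_space, `|f| ^+ 2 = rkhs_dot f f ;
  rkhs_eval : {linear rkhs_space -> (X -> R)} ;
  rkhs_eval_inj : injective rkhs_eval ;
  rkhs_feature : X -> rkhs_space ;
  rkhs_reproducing : forall (f : rkhs_space) (x : X),
    rkhs_dot f (rkhs_feature x) = rkhs_eval f x }.

Arguments rkhs_dot {R X} _.
Arguments rkhs_eval {R X} _.
Arguments rkhs_feature {R X} _.

Definition rkhs_kernel (R : realType) (X : Type) (H : rkhs R X) (x y : X) : R :=
  rkhs_eval H (rkhs_feature H x) y.

Section independence.
Context {d} {T : measurableType d} {R : realType} (P : probability T R).

Definition independent_RVs (I : choiceType) d' (T' : measurableType d')
    (X : I -> {RV P >-> T'}) : Prop :=
  forall (J : {fset I}) (A : I -> set T'),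
    (forall i, measurable (A i)) ->
    P (\bigcap_(i in [set` J]) (X i @^-1` A i)) =
    (\prod_(i <- J) P (X i @^-1` A i))%E.

(* Convergence in distribution of real random variables Y t to the law mu:
   convergence of the distribution functions at the continuity points of the
   limit. Being a sequence of random variables is part of the claim. *)
Definition cvg_in_distribution (Y : nat -> T -> R)
    (mu : probability (measurableTypeR R) R) : Prop :=
  (forall t, measurable_fun [set: T] (Y t)) /\
  (forall x : R, {for x, continuous (fun y : R => mu `]-oo, y]%classic)} ->
     P [set w | Y t w <= x] @[t --> \oo] --> mu `]-oo, x]%classic).

End independence.

(* [normal_prob] is parametrised by the standard deviation, and is not the
   point mass when the latter vanishes. *)
Definition centered_normal (R : realType) (v : R) :
    probability (measurableTypeR R) R :=
  if v == 0 then (\d_(0 : measurableTypeR R) : probability _ R)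
  else (normal_prob 0 (Num.sqrt v) : probability _ R).

Section gmmd.
Context {R : realType} {X : pmetricType R} (H : rkhs R X) {s : nat}.

(* [m] is E(K(Z, .)), in the weak sense. *)
Definition is_mean_embedding d (T : measurableType d) (P : probability T R)
    (Z : T -> X) (m : H) : Prop :=
  forall f : H, ('E_P[rkhs_eval H f \o Z] = (rkhs_dot H m f)%:E)%E.

Definition gmmd2 (rho : 'I_s -> R) (m : 'I_s -> H) : R :=
  \sum_j \sum_(l | l != j) rho l * `|m j - m l| ^+ 2.

Definition total_size (n : 'I_s -> nat) : nat := (\sum_j n j)%N.

Definition prop_size (n : 'I_s -> nat) (j : 'I_s) : R :=
  (n j)%:R / (total_size n)%:R.

(* Observations and weights are numbered from 0: [x j i] is the (i+1)-st
   observation of the j-th sample, [k r i g] the weight of index (i+1, r). *)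
Definition gmmd2_estimator (k : forall r, 'I_r -> R -> R) (g : R)
    (n : 'I_s -> nat) (x : 'I_s -> nat -> X) : R :=
  \sum_j \sum_(l | l != j) prop_size n l *
    ((n j)%:R ^- 2 * (\sum_(i < n j) \sum_(p < n j) rkhs_kernel H (x j i) (x j p))
     + (n l)%:R ^- 2 * (\sum_(i < n l) \sum_(p < n l) rkhs_kernel H (x l i) (x l p))
     - 2 / ((n j)%:R * (n l)%:R) *
       (\sum_(i < n j) \sum_(p < n l)
          k (n j) i g * rkhs_kernel H (x j i) (x l p))).

Definition Ufun (rho : 'I_s -> R) (m : 'I_s -> H) (j : 'I_s) (x : X) : R :=
  rkhs_dot H (rkhs_feature H x - m j)
    ((1 - 2 * rho j + s%:R * rho j) *: m j + rho j *: (m j - \sum_l m l)).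

Definition Vfun (rho : 'I_s -> R) (m : 'I_s -> H) (j : 'I_s) (x : X) : R :=
  rkhs_dot H (rkhs_feature H x - m j) ((\sum_l rho l *: m l) - rho j *: m j).

(* [Z j] plays the role of the first observation of the j-th sample and [k2]
   that of k^2(gamma). *)
Definition asymptotic_variance d (T : measurableType d) (P : probability T R)
    (Z : 'I_s -> T -> X) (rho : 'I_s -> R) (m : 'I_s -> H) (k2 : R) : R :=
  \sum_j 4 * (rho j)^-1 *
    (fine (variance P (Ufun rho m j \o Z j))
     + k2 * fine (variance P (Vfun rho m j \o Z j))
     - 2 * fine (covariance P (Ufun rho m j \o Z j) (Vfun rho m j \o Z j))).

End gmmd.

(* Main.v *)
Require Import Defs.
From HB Require Import structures.
From mathcomp Require Import all_boot all_order all_algebra sesquilinear finmap.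
From mathcomp Require Import all_classical all_reals all_analysis.
From mathcomp Require Import measurable_realfun ring lra.

(** The estimator is a quadratic expression in the empirical means of the feature
maps K(X_i, .), plain and weighted.  Write the plain mean of the j-th sample as
m_j + D_j and the weighted one as kappa_j m_j + E_j, where kappa_j is the mean
weight.  The estimation error is then the sum of
- a part linear in the D_j and E_j, with the limiting proportions rho as
  coefficients: it is 2 sum_j (<D_j, a_j> - <E_j, b_j>), where a_j and b_j are
  the elements of H that define U_j and V_j ([sum_lin_term]);
- a remainder in which every term either is a product of two deviations, or has
  a factor pi_l - rho_l, which is o(1/sqrt n), or kappa_j - 1, which is O(1/n_j)
  ([estimator_expansion]).
Centred features of distinct observations are orthogonal in mean
([mean_centered_kernel]), so |D_j|^2 and |E_j|^2 have expectation of order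
1/n_j ([mean_weighted_dev_sqr]), and sqrt n times the remainder tends to 0 in L^1
([mean_remainder]).

The linear part, times sqrt n, is a sum over all observations of independent
centred variables of size O(1/sqrt n) ([summand]), whose variances add up to a
quantity converging to sigma^2 ([sum_mean_summand_sqr]).  The central limit
theorem for it is proved by Lindeberg's replacement method, arranged so that no
Gaussian random variable has to be constructed.  Let Phi be the standard normal
distribution function.  Then u(tau, b) = Phi(b / sqrt tau) solves the heat
equation u_tau = u_bb / 2, so that in E u(tau, a - S) adding to S an
independent centred xi of variance v has the same effect as increasing tau by
v, up to an error C (E|xi|^3 + v^2) ([heat_step], [lindeberg_step]).  Doing so
for all summands turns E Phi((a - W) / e) into Phi(a / sqrt (e^2 + V)), where V
is the variance of the sum W ([lindeberg_sum], [lindeberg_cvg]).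

Since Phi((a - y) / e) is a smooth approximation of the indicator of y <= a,
this gives the limit of the distribution functions at the continuity points of
the limit law; the argument covers sigma = 0 as well, and absorbs the remainder
([cvg_in_distribution_normal]).

Elements of H need not be measurable functions of the observations.  The proof
only evaluates linear combinations of features and of mean embeddings, and a
mean embedding is measurable because it is a partial integral of the kernel
([testable_mean]). *)

Set Implicit Arguments.
Unset Strict Implicit.
Unset Printing Implicit Defensive.
Import Order.TTheory GRing.Theory Num.Theory.
Import numFieldNormedType.Exports.
Local Open Scope classical_set_scope.
Local Open Scope ring_scope.

(** * Bounded measurable functions and their means *)

Section bounded_measurable.
Context {d} {T : measurableType d} {R : realType}.
Implicit Types f g : T -> R.

(** All random variables of the proof are bounded, the kernel being bounded.  Bounded
measurable functions are stable under algebraic operations and integrable for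
every probability, which makes the real-valued integral linear on them. *)
Definition bmf f := measurable_fun [set: T] f /\ exists M, forall x, `|f x| <= M.

Lemma bmf_cst c : bmf (fun _ => c).
Proof. by split=> //; exists `|c|. Qed.

Lemma bmfD f g : bmf f -> bmf g -> bmf (fun x => f x + g x).
Proof.
move=> [mf [M fM]] [mg [N gN]]; split; first exact: measurable_funD.
by exists (M + N) => x; rewrite (le_trans (ler_normD _ _))// lerD.
Qed.

Lemma bmfM f g : bmf f -> bmf g -> bmf (fun x => f x * g x).
Proof.
move=> [mf [M fM]] [mg [N gN]]; split; first exact: measurable_funM.
by exists (M * N) => x; rewrite normrM ler_pM.
Qed.

Lemma bmfZ c f : bmf f -> bmf (fun x => c * f x).
Proof. by move=> bf; apply: bmfM bf; exact: bmf_cst. Qed.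

Lemma bmfB f g : bmf f -> bmf g -> bmf (fun x => f x - g x).
Proof.
move=> bf bg; under eq_fun do rewrite -mulN1r.
by apply: bmfD => //; exact: bmfZ.
Qed.

Lemma bmf_norm f : bmf f -> bmf (fun x => `|f x|).
Proof.
move=> [mf [M fM]]; split; first by apply: measurableT_comp mf.
by exists M => x; rewrite normr_id.
Qed.

Lemma bmf_sqr f : bmf f -> bmf (fun x => f x ^+ 2).
Proof. by move=> bf; under eq_fun do rewrite expr2; exact: bmfM. Qed.

Lemma bmf_sum (I : Type) (r : seq I) (Q : pred I) (F : I -> T -> R) :
  (forall i, Q i -> bmf (F i)) -> bmf (fun x => \sum_(i <- r | Q i) F i x).
Proof.
move=> bF; elim: r => [|i r IH].
  rewrite [X in bmf X](_ : _ = fun=> 0); first exact: bmf_cst.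
  by apply/funext => x; rewrite big_nil.
rewrite [X in bmf X](_ : _ = fun x => if Q i then
  F i x + \sum_(j <- r | Q j) F j x else \sum_(j <- r | Q j) F j x); last first.
  by apply/funext => x; rewrite big_cons.
case: (boolP (Q i)) => // Qi.
by apply: bmfD => //; exact: bF.
Qed.

Variable P : probability T R.

Lemma bmf_integrable f : bmf f -> P.-integrable [set: T] (EFin \o f).
Proof.
move=> [mf [M fM]]; apply: measurable_bounded_integrable => //.
  by rewrite ltey_eq fin_num_measure.
exists M; split; first exact: num_real.
by move=> N MN x _ /=; rewrite (le_trans (fM x))// ltW.
Qed.

Lemma bmf_meanD f g : bmf f -> bmf g ->
  \int[P]_x (f x + g x) = \int[P]_x f x + \int[P]_x g x.
Proof. by move=> bf bg; rewrite RintegralD//; exact: bmf_integrable. Qed.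

Lemma bmf_meanB f g : bmf f -> bmf g ->
  \int[P]_x (f x - g x) = \int[P]_x f x - \int[P]_x g x.
Proof. by move=> bf bg; rewrite RintegralB//; exact: bmf_integrable. Qed.

Lemma bmf_meanZ c f : bmf f -> \int[P]_x (c * f x) = c * \int[P]_x f x.
Proof. by move=> bf; rewrite RintegralZl//; exact: bmf_integrable. Qed.

Lemma mean_cst c : \int[P]_x c = c.
Proof.
rewrite Rintegral_cst// (_ : _ setT = 1%E) ?mulr1//.
exact: probability_setT.
Qed.

Lemma bmf_mean_sum (I : Type) (r : seq I) (Q : pred I) (F : I -> T -> R) :
  (forall i, Q i -> bmf (F i)) ->
  \int[P]_x (\sum_(i <- r | Q i) F i x) = \sum_(i <- r | Q i) \int[P]_x F i x.
Proof.
move=> bF; elim: r => [|i r IH].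
  by rewrite big_nil -[RHS]mean_cst; apply: eq_Rintegral => x _; rewrite big_nil.
rewrite big_cons.
under eq_Rintegral => x _ do rewrite big_cons.
case: (boolP (Q i)) => // Qi; rewrite bmf_meanD ?IH//; first exact: bF.
exact: bmf_sum.
Qed.

Lemma bmf_mean_le f g : bmf f -> bmf g -> (forall x, f x <= g x) ->
  \int[P]_x f x <= \int[P]_x g x.
Proof.
by move=> bf bg fg; apply: le_Rintegral => //; exact: bmf_integrable.
Qed.

Lemma bmf_mean_norm f : bmf f -> `|\int[P]_x f x| <= \int[P]_x `|f x|.
Proof. by move=> bf; apply: le_normr_Rintegral => //; exact: bmf_integrable. Qed.

Lemma bmf_expectation f : bmf f -> ('E_P[f] = (\int[P]_x f x)%:E)%E.
Proof.
move=> bf; rewrite unlock /Rintegral fineK//.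
by apply: integrable_fin_num => //; exact: bmf_integrable.
Qed.

End bounded_measurable.

Lemma bmf_indic {d} {T : measurableType d} {R : realType} (A : set T) :
  measurable A -> bmf (\1_A : T -> R).
Proof.
move=> mA; split; first exact: measurable_indic.
by exists 1 => x; rewrite indicE; case: (_ \in _); rewrite ?normr1 ?normr0.
Qed.

Lemma mean_indic {d} {T : measurableType d} {R : realType} (P : probability T R)
  (A : set T) : measurable A -> \int[P]_x (\1_A x) = fine (P A).
Proof. by move=> mA; rewrite /Rintegral integral_indic// setIT. Qed.

Lemma bmf_comp {d d'} {T : measurableType d} {T' : measurableType d'}
  {R : realType} (h : T' -> T) (f : T -> R) :
  measurable_fun [set: T'] h -> bmf f -> bmf (fun x => f (h x)).
Proof.
move=> mh [mf [M fM]]; split; first exact: measurableT_comp mh.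
by exists M => x; exact: fM.
Qed.

Section two_variables.
Context {d1 d2} {T1 : measurableType d1} {T2 : measurableType d2} {R : realType}.
Variable F : T1 * T2 -> R.
Hypothesis bF : bmf F.

Lemma bmf_section1 x : bmf (fun y => F (x, y)).
Proof.
have [mF [M FM]] := bF; split; last by exists M => y; exact: FM.
exact: measurableT_comp.
Qed.

(** Measurability of a partial integral is part of Fubini's theorem on a product
space; as it only involves the measure of the second factor, any measure will
do on the first one, such as a Dirac mass. *)
Lemma bmf_partial_mean (Q : probability T2 R) : bmf (fun x => \int[Q]_y F (x, y)).
Proof.
have [mF [M FM]] := bF; split; last first.
  exists M => x; rewrite (le_trans (bmf_mean_norm Q (bmf_section1 x)))//.
  rewrite -[leRHS](mean_cst Q); apply: bmf_mean_le => //.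
    exact/bmf_norm/bmf_section1.
  exact: bmf_cst.
pose x0 : T1 := point; apply: (measurableT_comp (f := fine)) => //.
apply: (@measurable_fubini_F _ _ _ _ _ (dirac x0) Q (EFin \o F)).
apply: measurable_bounded_integrable => //.
- rewrite -setXTT [X in (X < _)%E](product_measure1E (dirac x0) Q)//.
  rewrite (_ : _ * _ = 1)%E ?ltry//.
  by rewrite -[RHS]mul1e; congr (_ * _)%E; [exact: diracT|exact: probability_setT].
- exists M; split; first exact: num_real.
  by move=> N MN z _ /=; rewrite (le_trans (FM z))// ltW.
Qed.

End two_variables.

Section independent_pair.
Context {d d1 d2} {T : measurableType d} {T1 : measurableType d1}
  {T2 : measurableType d2} {R : realType} (P : probability T R).

Definition indep_pair (Z1 : T -> T1) (Z2 : T -> T2) :=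
  forall A B, measurable A -> measurable B ->
  P (Z1 @^-1` A `&` Z2 @^-1` B) = (P (Z1 @^-1` A) * P (Z2 @^-1` B))%E.

(** The joint law of an independent pair is the product of the marginal laws, so
this is Fubini's theorem transported to the probability space: the second
variable may be integrated separately, as if it were an independent copy. *)
Lemma indep_pair_mean (Z1 : T -> T1) (Z2 : T -> T2) (F : T1 * T2 -> R) :
  measurable_fun [set: T] Z1 -> measurable_fun [set: T] Z2 ->
  indep_pair Z1 Z2 -> bmf F ->
  \int[P]_w F (Z1 w, Z2 w) = \int[P]_w \int[P]_w' F (Z1 w, Z2 w').
Proof.
move=> m1 m2 ind bF; have [mF [M FM]] := bF.
pose V1 : {RV P >-> T1} := mfun_Sub (mem_set m1).
pose V2 : {RV P >-> T2} := mfun_Sub (mem_set m2).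
have mZ : measurable_fun [set: T] (fun w => (Z1 w, Z2 w)) by exact: measurable_fun_pair.
pose V : {RV P >-> (T1 * T2)%type} := mfun_Sub (mem_set mZ).
pose D1 : probability T1 R := distribution P V1.
pose D2 : probability T2 R := distribution P V2.
have DE A : measurable A -> (D1 \x D2)%E A = distribution P V A.
  by move=> mA; apply: product_measure_unique.
have iF : (D1 \x D2)%E.-integrable [set: T1 * T2] (EFin \o F).
  apply: measurable_bounded_integrable => //.
    rewrite (_ : _ [set: _] = 1)%E ?ltry//.
    exact: (etrans (DE setT measurableT) (probability_setT (distribution P V))).
  exists M; split; first exact: num_real.
  by move=> N MN z _ /=; rewrite (le_trans (FM z))// ltW.
have F2 x : \int[P]_w' F (x, Z2 w') = \int[D2]_y F (x, y).
  congr fine; rewrite integral_distribution//.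
    by apply/measurable_EFinP; have [] := bmf_section1 bF x.
  exact: (bmf_integrable P (bmf_comp m2 (bmf_section1 bF x))).
under [RHS]eq_Rintegral => w _ do rewrite F2.
have -> : \int[P]_w \int[D2]_y F (Z1 w, y) = \int[D1]_x \int[D2]_y F (x, y).
  congr fine; rewrite integral_distribution//.
    by apply/measurable_EFinP; have [] := bmf_partial_mean bF D2.
  exact: (bmf_integrable P (bmf_comp m1 (bmf_partial_mean bF D2))).
transitivity (fine (\int[D1]_x \int[D2]_y (F (x, y))%:E)); last first.
  congr fine; apply: eq_integral => x _; rewrite /Rintegral fineK//.
  by apply: integrable_fin_num => //; exact: (bmf_integrable D2 (bmf_section1 bF x)).
congr fine.
have -> := @integral12_prod_meas1 _ _ _ _ _ D1 D2 (EFin \o F) iF.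
rewrite (eq_measure_integral (distribution P V)); last by move=> A mA _; exact: DE.
rewrite integral_distribution//; first exact/measurable_EFinP.
exact: (bmf_integrable P (bmf_comp mZ bF)).
Qed.

End independent_pair.

Lemma indep_pair_sym {d d1 d2} {T : measurableType d} {T1 : measurableType d1}
  {T2 : measurableType d2} {R : realType} (P : probability T R)
  (Z1 : T -> T1) (Z2 : T -> T2) : indep_pair P Z1 Z2 -> indep_pair P Z2 Z1.
Proof. by move=> ind A B mA mB; rewrite setIC ind// muleC. Qed.

(** * Independent families *)

Lemma measurable_sum_in {d} {T : measurableType d} {R : realType}
  (I : eqType) (r : seq I) (h : I -> T -> R) :
  (forall i, i \in r -> measurable_fun [set: T] (h i)) ->
  measurable_fun [set: T] (fun w => \sum_(i <- r) h i w).
Proof.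
move=> mh.
apply: (eq_measurable_fun (fun w => \sum_(i <- r) (if i \in r then h i w else 0))).
  by move=> w _; rewrite big_seq [RHS]big_seq; apply: eq_bigr => i ->.
apply: measurable_sum => i; case: (boolP (i \in r)) => ir; first exact: mh.
exact: measurable_cst.
Qed.

Section independent_family.
Context {d d'} {T : measurableType d} {T' : measurableType d'} {R : realType}
  (P : probability T R) (I : choiceType) (X : I -> {RV P >-> T'}).
Hypothesis indX : independent_RVs X.

(** A pi-system generating the sigma-algebra of the variables indexed by [J]. *)
Definition cylinders (J : {fset I}) : set (set T) :=
  [set E | exists2 A : I -> set T', (forall i, measurable (A i)) &
    E = \bigcap_(i in [set` J]) (X i @^-1` A i)].

Lemma measurable_cylinder J : cylinders J `<=` measurable.
Proof.
move=> _ [A mA ->]; apply: fin_bigcap_measurable => //.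
by move=> i _; rewrite -[X in measurable X]setTI; apply: measurable_funP.
Qed.

Lemma cylinders_setI J : setI_closed (cylinders J).
Proof.
move=> _ _ [A mA ->] [B mB ->]; exists (fun i => A i `&` B i).
  by move=> i; exact: measurableI.
apply/seteqP; split=> [w [wA wB] i Ji|w wAB]; first by split; [exact: wA|exact: wB].
by split=> i Ji; have [] := wAB i Ji.
Qed.

Lemma cylinders_setT J : cylinders J setT.
Proof.
exists (fun=> setT) => //.
by apply/seteqP; split=> // w _ i _.
Qed.

Lemma cylinders_preimage (J : {fset I}) i (B : set T') :
  i \in J -> measurable B -> cylinders J (X i @^-1` B).
Proof.
move=> iJ mB; exists (fun j => if j == i then B else setT).
  by move=> j; case: ifP.
apply/seteqP; split=> [w wB j Jj /=|w /(_ i iJ) /=]; last by rewrite eqxx.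
by case: eqP => [->|].
Qed.

(** Independence of the finite subfamilies is the product rule on cylinders.  It
extends to the generated sigma-algebra because two finite measures that agree
on a pi-system agree on what it generates. *)
Lemma indep_sigma_cylinders (J : {fset I}) x (B : set T') (E : set T) :
  x \notin J -> measurable B -> <<s cylinders J >> E ->
  P (X x @^-1` B `&` E) = (P (X x @^-1` B) * P E)%E.
Proof.
move=> xJ mB sE.
have mXB : measurable (X x @^-1` B).
  by rewrite -[X in measurable X]setTI; apply: measurable_funP.
have PB0 : 0 <= fine (P (X x @^-1` B)) by exact: fine_ge0.
(* both sides of the product rule, as finite measures in [E] *)
pose m1 : {measure set T -> \bar R} := mrestr P mXB.
pose m2 : {measure set T -> \bar R} := mscale (NngNum PB0) P.
suff : m1 E = m2 E.
  rewrite /m1 /m2 /= /mrestr /mscale/= fineK; last exact: fin_num_measure.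
  by rewrite setIC.
apply: (@g_sigma_algebra_measure_unique _ _ _ (cylinders J) _ (fun=> setT)) => //.
- exact: measurable_cylinder.
- by move=> _; exact: cylinders_setT.
- by rewrite bigcup_const//; exists 0%N.
- exact: cylinders_setI.
- move=> _ [A mA ->].
  rewrite /m1 /m2 /= /mrestr /mscale/= fineK; last exact: fin_num_measure.
  (* a cylinder over J intersected with the event on X x is a cylinder over x |` J *)
  pose A' i := if i == x then B else A i.
  have mA' i : measurable (A' i) by rewrite /A'; case: ifP.
  have A'E i : i \in J -> A' i = A i.
    by move=> iJ; rewrite /A'; case: eqP xJ => // <-; rewrite iJ.
  have -> : \bigcap_(i in [set` J]) (X i @^-1` A i) `&` X x @^-1` B =
      \bigcap_(i in [set` (x |` J)%fset]) (X i @^-1` A' i).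
    apply/seteqP; split=> [w [wA wB] i /=|w wA].
      rewrite in_fset1U => /orP[/eqP ->|iJ]; first by rewrite /A' eqxx.
      by rewrite A'E//; exact: wA.
    split=> [i /= iJ|].
      by rewrite -A'E//; apply: wA => /=; rewrite in_fset1U iJ orbT.
    by have /= := wA x; rewrite in_fset1U eqxx /A' eqxx; exact.
  rewrite !indX// big_fsetU1//= {1}/A' eqxx; congr (_ * _)%E.
  by rewrite big_seq [RHS]big_seq; apply: eq_bigr => i iJ; rewrite A'E.
- move=> _; rewrite /m1 /= /mrestr.
  by rewrite ltey_eq fin_num_measure// setTI.
Qed.

Lemma independent_RVs_pair x y : x != y -> indep_pair P (X x) (X y).
Proof.
move=> xy A B mA mB; apply: (@indep_sigma_cylinders [fset y]%fset) => //.
  by rewrite in_fset1.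
by apply: sub_sigma_algebra; apply: cylinders_preimage; rewrite ?in_fset1.
Qed.

Lemma independent_RVs_sum (f : I -> T' -> R) (r : seq I) x :
  (forall i, measurable_fun [set: T'] (f i)) -> x \notin r ->
  indep_pair P (fun w => f x (X x w)) (fun w => \sum_(i <- r) f i (X i w)).
Proof.
move=> mf xr A B mA mB.
pose J := [fset i in r]%fset.
have JE i : (i \in J) = (i \in r) by rewrite !inE.
have mS : @measurable_fun _ _ (g_sigma_algebraType (cylinders J)) R setT (fun w => \sum_(i <- r) f i (X i w)).
  apply: measurable_sum_in => i ir.
  apply: (measurableT_comp (mf i)) => _ C mC; rewrite setTI.
  by apply: sub_sigma_algebra; apply: cylinders_preimage; rewrite ?JE.
apply: (@indep_sigma_cylinders J x (f x @^-1` A)).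
- by rewrite JE.
- by rewrite -[X in measurable X]setTI; exact: mf.
- by have := mS measurableT B mB; rewrite setTI.
Qed.

End independent_family.

(** * A Taylor bound *)

Section taylor.
Context {R : realType}.
Implicit Types f : R -> R.

(** The order of [x] and [y] is left free, so that increments of both signs are
covered. *)
Lemma mvt_bound f df (x y M : R) :
  (forall t, Num.min x y <= t <= Num.max x y ->
     is_derive t 1 f (df t) /\ `|df t| <= M) ->
  `|f y - f x| <= M * `|y - x|.
Proof.
wlog xy : x y / x <= y => [hwlog H|H].
  case: (leP x y) => [|/ltW] xy; first exact: hwlog.
  rewrite distrC (distrC y); apply: hwlog => // t.
  by rewrite minC maxC; exact: H.
have H' t : t \in `[x, y] -> is_derive t 1 f (df t) /\ `|df t| <= M.
  by rewrite in_itv/= => xty; apply: H; rewrite (min_idPl xy) (max_idPr xy).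
have [t|t|c cxy ->] := @MVT_segment R f df x y xy.
- by move=> /subset_itv_oo_cc/H'[].
- apply: derivable_within_continuous => {}t /H'[] /@ex_derive.
  by [].
- by rewrite normrM ler_wpM2r//; have [] := H' c cxy.
Qed.

(** Three applications of the mean value inequality; the constant is not optimal,
only the order of magnitude in [h] matters. *)
Lemma taylor2_bound f f1 f2 f3 (M : R) :
  (forall t : R, is_derive t 1 f (f1 t)) -> (forall t : R, is_derive t 1 f1 (f2 t)) ->
  (forall t : R, is_derive t 1 f2 (f3 t)) -> (forall t, `|f3 t| <= M) ->
  forall x h,
  `|f (x + h) - f x - h * f1 x - h ^+ 2 / 2 * f2 x| <= M * `|h| ^+ 3.
Proof.
move=> d1 d2 d3 f3M x h.
have E2 y : `|f2 y - f2 x| <= M * `|y - x|.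
  by apply: mvt_bound => t _; split; [exact: d3|exact: f3M].
have M0 : 0 <= M by rewrite (le_trans _ (f3M 0)).
have between t y : Num.min x y <= t <= Num.max x y -> `|t - x| <= `|y - x|.
  rewrite ge_min le_max => /andP[/orP[xt|yt] /orP[tx|ty]].
  - by rewrite (_ : t = x) ?subrr ?normr0//; apply/eqP; rewrite eq_le xt tx.
  - by rewrite !ger0_norm; lra.
  - by rewrite !ler0_norm; lra.
  - by rewrite (_ : t = y)//; apply/eqP; rewrite eq_le yt ty.
have E1 y : `|(f1 y - y * f2 x) - (f1 x - x * f2 x)| <= M * `|y - x| * `|y - x|.
  apply: (@mvt_bound (fun y => f1 y - y * f2 x) (fun y => f2 y - f2 x)) => t xty.
  split.
    have ? := d2 t.
    by apply: is_derive_eq; rewrite /GRing.scale/=; ring.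
  by rewrite (le_trans (E2 t))// ler_wpM2l// between.
have E0 : `|(f (x + h) - (x + h) * f1 x - ((x + h) - x) ^+ 2 / 2 * f2 x)
      - (f x - x * f1 x - (x - x) ^+ 2 / 2 * f2 x)|
    <= M * `|x + h - x| * `|x + h - x| * `|x + h - x|.
  apply: (@mvt_bound (fun y => f y - y * f1 x - (y - x) ^+ 2 / 2 * f2 x)
    (fun y => f1 y - f1 x - (y - x) * f2 x)) => t xty.
  split.
    have ? := d1 t.
    by apply: is_derive_eq; rewrite /GRing.scale/=; field.
  rewrite (_ : f1 t - _ - _ = (f1 t - t * f2 x) - (f1 x - x * f2 x)); last ring.
  by rewrite (le_trans (E1 t))// ler_pM ?mulr_ge0 ?ler_wpM2l// between.
rewrite (_ : _ - _ - _ - _ = (f (x + h) - (x + h) * f1 x - (x + h - x) ^+ 2 / 2 * f2 x)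
      - (f x - x * f1 x - (x - x) ^+ 2 / 2 * f2 x)); last by field.
rewrite (le_trans E0)// (_ : x + h - x = h); last ring.
by rewrite -!mulrA -expr2 -exprS.
Qed.

End taylor.

(** * The normal distribution function and the heat equation *)

Section normal_cdf.
Context {R : realType}.
Implicit Types s x y : R.

Definition normal_cdf s x : R := fine (normal_prob 0 s `]-oo, x]).

Lemma normal_cdfE s x : (normal_prob 0 s `]-oo, x] = (normal_cdf s x)%:E)%E.
Proof. by rewrite /normal_cdf fineK// fin_num_measure. Qed.

Lemma normal_cdf_bounds s x : 0 <= normal_cdf s x <= 1.
Proof.
rewrite fine_ge0//= -lee_fin -normal_cdfE; exact: probability_le1.
Qed.

Lemma normal_cdf_nd s x y : x <= y -> normal_cdf s x <= normal_cdf s y.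
Proof.
move=> xy; rewrite fine_le ?fin_num_measure//; apply: le_measure; rewrite ?inE//.
by apply: subset_itvl; rewrite bnd_simp.
Qed.

Lemma is_derive_normal_cdf s x : s != 0 ->
  is_derive x 1 (normal_cdf s) (normal_pdf 0 s x).
Proof.
move=> s0.
have [] := @continuous_FTC1 R (normal_pdf 0 s) -oo%O x (x + 1).
- by rewrite ltrDl.
- by apply: integrableS (integrable_normal_pdf 0 s).
- by rewrite ltNyr.
- exact: continuous_normal_pdf.
move=> dF F'; apply: DeriveDef; first exact: dF.
by rewrite -derive1E F'.
Qed.

(** The identity as a random variable under a normal law, whose distribution
function is then [normal_cdf]. *)
Let idR : measurableTypeR R -> R := idfun.

#[local] HB.instance Definition _ :=
  @isMeasurableFun.Build _ _ _ _ idR (@measurable_id _ _ setT).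

Lemma normal_cdf_cvg s :
  normal_cdf s x @[x --> -oo] --> (0 : R) /\ normal_cdf s x @[x --> +oo] --> (1 : R).
Proof.
pose X : {RV (normal_prob 0 s : probability (measurableTypeR R) R) >-> R} := idR.
by split; [exact: (fine_cvg (cvg_cdfNy0 X))|exact: (fine_cvg (cvg_cdfy1 X))].
Qed.

Definition stdn_pdf x : R := normal_pdf 0 1 x.
Definition stdn_cdf x : R := normal_cdf 1 x.

Lemma stdn_pdfE x : stdn_pdf x = normal_peak 1 * expR (- (x ^+ 2 / 2)).
Proof.
rewrite /stdn_pdf normal_pdfE ?oner_neq0// /normal_fun subr0 expr1n mulNr.
by [].
Qed.

Lemma is_derive_stdn_cdf x : is_derive x 1 stdn_cdf (stdn_pdf x).
Proof. by apply: is_derive_normal_cdf; rewrite oner_neq0. Qed.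

Lemma is_derive_stdn_pdf x : is_derive x 1 stdn_pdf (- x * stdn_pdf x).
Proof.
rewrite (_ : stdn_pdf = fun x => normal_peak 1 * expR (- (x ^+ 2 / 2))); last first.
  by apply/funext => y; rewrite stdn_pdfE.
have d2 : is_derive x 1 (fun x : R => - (x ^+ 2 / 2)) (- x).
  by apply: is_derive_eq; rewrite /GRing.scale/=; field.
have ? := @is_derive1_comp R expR _ x _ _ (is_derive_expR _) d2.
apply: is_derive_eq; rewrite /GRing.scale/=; ring.
Qed.


Lemma normal_pdf_scale s x : 0 < s -> normal_pdf 0 s x = stdn_pdf (x / s) / s.
Proof.
move=> s0; rewrite stdn_pdfE normal_pdfE ?gt_eqF// /normal_fun /normal_peak subr0.
rewrite expr1n mul1r -mulrnAr sqrtrM ?sqr_ge0// sqrtr_sqr gtr0_norm// invfM.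
have -> : - x ^+ 2 / (s ^+ 2 *+ 2) = - ((x / s) ^+ 2 / 2).
  by rewrite -mulr_natr; field; rewrite gt_eqF.
by rewrite -mulrA mulrC.
Qed.

(** Both sides have the same derivative and tend to 0 at minus infinity. *)
Lemma normal_cdf_scale s x : 0 < s -> normal_cdf s x = stdn_cdf (x / s).
Proof.
move=> s0; pose h y := normal_cdf s y - stdn_cdf (y / s).
have hx y : h y = h x.
  apply/eqP; rewrite -subr_eq0 -normr_le0.
  rewrite -(mul0r `|y - x|); apply: (@mvt_bound _ _ (fun=> 0)) => t _.
  rewrite normr0; split => //.
  have d1 : is_derive t 1 (fun y : R => y / s) s^-1.
    by apply: is_derive_eq; rewrite /GRing.scale/=; ring.
  have d2 := @is_derive1_comp R stdn_cdf _ t _ _ (is_derive_stdn_cdf (t / s)) d1.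
  have d3 := @is_derive_normal_cdf s t.
  have {}d3 := d3 (lt0r_neq0 s0).
  apply: is_derive_eq.
  by rewrite normal_pdf_scale// subrr.
have h0 : h y @[y --> -oo] --> (0 : R).
  rewrite -[X in _ --> X](subrr 0); apply: cvgB.
    by have [] := normal_cdf_cvg s.
  have sy : (y / s) @[y --> -oo] --> -oo.
    by apply: gt0_cvgMlNy; rewrite ?invr_gt0//; exact: cvg_id.
  exact: (cvg_comp _ _ sy (normal_cdf_cvg 1).1).
have h1 : h y @[y --> -oo] --> h x.
  by rewrite (_ : h = fun=> h x); [exact: cvg_cst|apply/funext].
have h00 : h x = 0 := cvg_unique (@norm_hausdorff _ _) h1 h0.
by apply/eqP; rewrite -subr_eq0; apply/eqP; exact: h00.
Qed.

Lemma continuous_stdn_cdf : continuous stdn_cdf.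
Proof.
move=> x; apply: differentiable_continuous; apply/derivable1_diffP.
by have := is_derive_stdn_cdf x => /@ex_derive.
Qed.

Lemma measurable_stdn_cdf : measurable_fun [set: R] stdn_cdf.
Proof. exact: continuous_measurable_fun continuous_stdn_cdf. Qed.

Lemma stdn_pdf_ge0 x : 0 <= stdn_pdf x.
Proof. exact: normal_pdf_ge0. Qed.

(** exp (y^2/2) = (exp (y^2/4))^2 >= (1 + y^2/4)^2, which dominates (1 + y^4)/16. *)
Lemma stdn_pdf_decay x : (1 + x ^+ 4) * stdn_pdf x <= 16 * normal_peak 1.
Proof.
rewrite stdn_pdfE expRN mulrCA [leRHS]mulrC ler_wpM2l ?normal_peak_ge0//.
rewrite ler_pdivrMr ?expR_gt0//.
have -> : expR (x ^+ 2 / 2) = expR (x ^+ 2 / 4) ^+ 2.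
  by rewrite -expRM_natl; congr expR; field.
have e1 : 1 + x ^+ 2 / 4 <= expR (x ^+ 2 / 4) by exact: expR_ge1Dx.
have x2 : 0 <= x ^+ 2 / 4 by rewrite divr_ge0 ?sqr_ge0.
have : (1 + x ^+ 2 / 4) ^+ 2 <= expR (x ^+ 2 / 4) ^+ 2.
  by rewrite lerXn2r ?nnegrE ?addr_ge0// expR_ge0.
have -> : x ^+ 4 = (x ^+ 2) ^+ 2 by ring.
have := sqr_ge0 x; nra.
Qed.

Lemma stdn_pdf_poly_bound (p x : R) : `|p| <= 1 + x ^+ 4 ->
  `|p * stdn_pdf x| <= 16 * normal_peak 1.
Proof.
move=> px; rewrite normrM (ger0_norm (stdn_pdf_ge0 x)).
by rewrite (le_trans _ (stdn_pdf_decay x))// ler_wpM2r// stdn_pdf_ge0.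
Qed.

Lemma stdn_cdf_space_taylor z h :
  `|stdn_cdf (z + h) - stdn_cdf z - h * stdn_pdf z - h ^+ 2 / 2 * (- z * stdn_pdf z)|
  <= 16 * normal_peak 1 * `|h| ^+ 3.
Proof.
apply: (@taylor2_bound R stdn_cdf stdn_pdf (fun z => - z * stdn_pdf z)
  (fun z => (z ^+ 2 - 1) * stdn_pdf z)) => t.
- exact: is_derive_stdn_cdf.
- exact: is_derive_stdn_pdf.
- have ? := is_derive_stdn_pdf t.
  by apply: is_derive_eq; rewrite /GRing.scale/=; ring.
- apply: stdn_pdf_poly_bound; rewrite ler_norml.
  have -> : t ^+ 4 = (t ^+ 2) ^+ 2 by ring.
  have := sqr_ge0 t; have := sqr_ge0 (t ^+ 2 - 1); nra.
Qed.

(** Scaling space by sqrt tau reduces the heat flow to the function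
w -> Phi(z / sqrt (1 + w)). *)
Definition rsqrt1 w : R := (Num.sqrt (1 + w))^-1.

Lemma is_derive_rsqrt1 (w : R) : 0 <= w -> is_derive w 1 rsqrt1 (- (rsqrt1 w ^+ 3) / 2).
Proof.
move=> w0; have w1 : 0 < 1 + w by rewrite ltr_pwDl.
have d1 : is_derive w 1 (fun t : R => 1 + t) 1.
  by apply: is_derive_eq; rewrite add0r mulr1.
have d2 := @is_derive1_comp R _ _ w _ _ (is_derive1_sqrt w1) d1.
have s0 : (Num.sqrt \o (fun t : R => 1 + t)) w != 0 by rewrite /= gt_eqF ?sqrtr_gt0.
have d3 := is_deriveV s0 d2.
apply: (is_derive_eq d3); rewrite /GRing.scale/= /rsqrt1.
by field; rewrite gt_eqF ?sqrtr_gt0.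
Qed.

(** The coefficient of [w] is half the second derivative of Phi at [z]: this is the
heat equation at time 1. *)
Lemma stdn_cdf_time_taylor z w : 0 <= w ->
  `|stdn_cdf (z * rsqrt1 w) - stdn_cdf z + w / 2 * (z * stdn_pdf z)|
  <= 16 * normal_peak 1 * w ^+ 2.
Proof.
move=> w0; set M := 16 * normal_peak 1.
have M0 : 0 <= M by rewrite mulr_ge0// normal_peak_ge0.
have q0 : rsqrt1 0 = 1 by rewrite /rsqrt1 addr0 sqrtr1 invr1.
(* the derivative of t -> Phi(z / sqrt (1 + t)) *)
pose G t := - (z * rsqrt1 t ^+ 3 * stdn_pdf (z * rsqrt1 t)) / 2.
have dq (t : R) : 0 <= t -> is_derive t 1 (fun t => z * rsqrt1 t) (- (z * rsqrt1 t ^+ 3) / 2).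
  move=> t0; have ? := is_derive_rsqrt1 t0.
  by apply: is_derive_eq; rewrite /GRing.scale/=; field.
have q1 t : 0 <= t -> 0 <= rsqrt1 t <= 1.
  move=> t0; rewrite /rsqrt1 invr_ge0 sqrtr_ge0/= invf_le1 ?sqrtr_gt0 ?ltr_pwDl//.
  by rewrite -[leLHS]sqrtr1 ler_wsqrtr// lerDl.
have E1 (t : R) : 0 <= t -> `|G t - G 0| <= M * t.
  move=> t0; rewrite -[X in _ <= _ * X](ger0_norm t0) -[X in _ <= _ * `|X|](subr0 t).
  apply: (@mvt_bound R G (fun t => rsqrt1 t ^+ 4 / 4 *
    ((3 * (z * rsqrt1 t) - (z * rsqrt1 t) ^+ 3) * stdn_pdf (z * rsqrt1 t)))) => r.
  rewrite (min_idPl t0) (max_idPr t0) => /andP[r0 rt]; split.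
    have d1 := is_derive_rsqrt1 r0.
    have d2 := @is_derive1_comp R _ _ r _ _ (is_derive_stdn_pdf (z * rsqrt1 r)) (dq r r0).
    by apply: is_derive_eq; rewrite /GRing.scale/=; field.
  set y := z * rsqrt1 r; rewrite mulrAC -mulrA normrM -[leRHS]mul1r ler_pM//.
    by rewrite ger0_norm ?exprn_ge0 ?exprn_ile1//; have /andP[] := q1 r r0.
  rewrite mulrAC; apply: stdn_pdf_poly_bound.
  have y4 : y ^+ 4 = (y ^+ 2) ^+ 2 by ring.
  rewrite ler_norml y4; have := sqr_ge0 y; have := sqr_ge0 (y - 1).
  have := sqr_ge0 (y + 1); have := sqr_ge0 (y ^+ 2 - y); have := sqr_ge0 (y ^+ 2 + y).
  nra.
have -> : w / 2 * (z * stdn_pdf z) = - (w * G 0) by rewrite /G q0 expr1n !mulr1; field.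
have -> : stdn_cdf (z * rsqrt1 w) - stdn_cdf z - w * G 0 =
    (stdn_cdf (z * rsqrt1 w) - w * G 0) - (stdn_cdf (z * rsqrt1 0) - 0 * G 0).
  by rewrite q0 mulr1; ring.
have -> : M * w ^+ 2 = M * w * `|w - 0| by rewrite subr0 ger0_norm// expr2 mulrA.
apply: (@mvt_bound R (fun t => stdn_cdf (z * rsqrt1 t) - t * G 0) (fun t => G t - G 0)) => t.
rewrite (min_idPl w0) (max_idPr w0) => /andP[t0 tw]; split.
  have d2 := @is_derive1_comp R _ _ t _ _ (is_derive_stdn_cdf (z * rsqrt1 t)) (dq t t0).
  by apply: is_derive_eq; rewrite /GRing.scale/= /G; field.
by rewrite (le_trans (E1 t t0))// ler_wpM2l.
Qed.

(** Comparison of the effect of a step [y] in space with that of a step [v] in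
time.  The terms in A and B are those that vanish in mean when the step is a
centred random variable of variance [v]; all the steps starting from the same
[tau] and [b] share them. *)
Definition heat_constant tau0 C := forall tau b v, tau0 <= tau -> 0 <= v ->
  exists A B, forall y,
  `|stdn_cdf ((b - y) / Num.sqrt tau) - stdn_cdf (b / Num.sqrt (tau + v))
    - (A * y + B * (y ^+ 2 - v))| <= C * (`|y| ^+ 3 + v ^+ 2).

Lemma heat_step tau0 : 0 < tau0 -> exists2 C, 0 <= C & heat_constant tau0 C.
Proof.
move=> tau00; pose M : R := 16 * normal_peak 1.
have M0 : 0 <= M by rewrite mulr_ge0// normal_peak_ge0.
pose C := M * (Num.sqrt tau0 ^- 3 + tau0 ^- 2).
exists C => [|tau b v tau0le v0].
  by rewrite mulr_ge0// addr_ge0// invr_ge0 exprn_ge0// ltW.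
have tau_gt0 : 0 < tau by rewrite (lt_le_trans tau00).
have st : 0 < Num.sqrt tau by rewrite sqrtr_gt0.
have st0 : 0 < Num.sqrt tau0 by rewrite sqrtr_gt0.
set z := b / Num.sqrt tau.
exists (- (stdn_pdf z / Num.sqrt tau)), (- (z * stdn_pdf z) / (2 * tau)) => y.
have w0 : 0 <= v / tau by rewrite divr_ge0// ltW.
have := stdn_cdf_space_taylor z (- (y / Num.sqrt tau)).
have := stdn_cdf_time_taylor z w0.
have -> : z * rsqrt1 (v / tau) = b / Num.sqrt (tau + v).
  rewrite /z /rsqrt1 -mulrA -invfM -sqrtrM 1?ltW//; congr (_ / Num.sqrt _).
  by field; rewrite gt_eqF.
have -> : z - y / Num.sqrt tau = (b - y) / Num.sqrt tau by rewrite mulrBl.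
set F1 := stdn_cdf (b / Num.sqrt (tau + v)).
set F2 := stdn_cdf ((b - y) / _) => H2 H1.
have {}H2 : `|F1 - stdn_cdf z + v / tau / 2 * (z * stdn_pdf z)| <= M * tau0 ^- 2 * v ^+ 2.
  rewrite (le_trans H2)// -/M expr_div_n -mulrA ler_wpM2l// mulrC ler_wpM2r ?sqr_ge0//.
  by rewrite lef_pV2 ?posrE ?exprn_gt0// lerXn2r ?nnegrE// ltW.
have {}H1 : `|F2 - stdn_cdf z - - (y / Num.sqrt tau) * stdn_pdf z -
    (- (y / Num.sqrt tau)) ^+ 2 / 2 * (- z * stdn_pdf z)| <= M * Num.sqrt tau0 ^- 3 * `|y| ^+ 3.
  rewrite (le_trans H1)// -/M normrN normrM normfV (gtr0_norm st) expr_div_n -mulrA.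
  rewrite ler_wpM2l// mulrC ler_wpM2r ?exprn_ge0//.
  by rewrite lef_pV2 ?posrE ?exprn_gt0// lerXn2r ?nnegrE ?ler_wsqrtr// ltW.
have -> : F2 - F1 - (- (stdn_pdf z / Num.sqrt tau) * y +
    - (z * stdn_pdf z) / (2 * tau) * (y ^+ 2 - v)) =
  (F2 - stdn_cdf z - - (y / Num.sqrt tau) * stdn_pdf z -
    (- (y / Num.sqrt tau)) ^+ 2 / 2 * (- z * stdn_pdf z)) -
  (F1 - stdn_cdf z + v / tau / 2 * (z * stdn_pdf z)).
  rewrite sqrrN expr_div_n sqr_sqrtr; last exact: ltW.
  by field; rewrite !gt_eqF.
rewrite (le_trans (ler_normB _ _))// (le_trans (lerD H1 H2))// /C.
have y3 : 0 <= `|y| ^+ 3 by rewrite exprn_ge0.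
have v2 := sqr_ge0 v.
have a0 : 0 <= M * Num.sqrt tau0 ^- 3 by rewrite mulr_ge0// invr_ge0 exprn_ge0// ltW.
have b0 : 0 <= M * tau0 ^- 2 by rewrite mulr_ge0// invr_ge0 exprn_ge0// ltW.
nra.
Qed.

End normal_cdf.

(** * Lindeberg replacement *)

Section lindeberg.
Context {d} {T : measurableType d} {R : realType} (P : probability T R).

Lemma bmf_stdn_cdf_comp {d'} {T' : measurableType d'} (f : T' -> R) (s : R) :
  measurable_fun [set: T'] f -> bmf (fun w => stdn_cdf (f w / s)).
Proof.
move=> mf; split.
  by apply: measurableT_comp => //; [exact: measurable_stdn_cdf|exact: measurable_funM].
exists 1 => w; have /andP[p0 p1] := normal_cdf_bounds 1 (f w / s).
by rewrite ger0_norm.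
Qed.

(** Conditionally on [S], the terms in A and B of [heat_constant] integrate to 0. *)
Lemma lindeberg_step (tau0 C tau a M v : R) (xi S : T -> R) :
  0 <= C -> heat_constant tau0 C -> tau0 <= tau ->
  bmf xi -> measurable_fun [set: T] S -> indep_pair P xi S ->
  (forall w, `|xi w| <= M) -> \int[P]_w xi w = 0 -> \int[P]_w (xi w ^+ 2) = v ->
  `|\int[P]_w stdn_cdf ((a - (xi w + S w)) / Num.sqrt tau)
    - \int[P]_w stdn_cdf ((a - S w) / Num.sqrt (tau + v))| <= C * (M * v + v ^+ 2).
Proof.
move=> C0 hC tautau0 bxi mS ind xiM xi0 xiv.
have mxi := bxi.1.
have v0 : 0 <= v by rewrite -xiv Rintegral_ge0// => w _; exact: sqr_ge0.
have bF : bmf (fun z : R * R => stdn_cdf ((a - z.1 - z.2) / Num.sqrt tau)).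
  apply: bmf_stdn_cdf_comp; apply: measurable_funB => //.
  exact: measurable_funB.
have -> : \int[P]_w stdn_cdf ((a - (xi w + S w)) / Num.sqrt tau) =
    \int[P]_w \int[P]_w' stdn_cdf ((a - S w - xi w') / Num.sqrt tau).
  rewrite -(indep_pair_mean mS mxi (indep_pair_sym ind) bF).
  by apply: eq_Rintegral => w _ /=; rewrite opprD addrA addrAC.
have bG : bmf (fun w => stdn_cdf ((a - S w) / Num.sqrt (tau + v))).
  by apply: bmf_stdn_cdf_comp; exact: measurable_funB.
have bH w : bmf (fun w' => stdn_cdf ((a - S w - xi w') / Num.sqrt tau)).
  by apply: bmf_stdn_cdf_comp; exact: measurable_funB.
have bK : bmf (fun w => \int[P]_w' stdn_cdf ((a - S w - xi w') / Num.sqrt tau)).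
  apply: (@bmf_partial_mean _ _ T T R
    (fun z => stdn_cdf ((a - S z.1 - xi z.2) / Num.sqrt tau))).
  apply: bmf_stdn_cdf_comp; apply: measurable_funB.
    by apply: measurable_funB => //; exact: (measurableT_comp mS).
  exact: (measurableT_comp mxi).
rewrite -bmf_meanB// (le_trans (bmf_mean_norm P (bmfB bK bG)))//.
rewrite -[leRHS](mean_cst P); apply: bmf_mean_le; first exact/bmf_norm/bmfB.
  exact: bmf_cst.
move=> w; have [A [B AB]] := hC tau (a - S w) v tautau0 v0.
have bx2 : bmf (fun w' => xi w' ^+ 2 - v) by apply: bmfB (bmf_cst _); exact: bmf_sqr.
have bL : bmf (fun w' => A * xi w' + B * (xi w' ^+ 2 - v)).
  by apply: bmfD; exact: bmfZ.
have L0 : \int[P]_w' (A * xi w' + B * (xi w' ^+ 2 - v)) = 0.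
  rewrite bmf_meanD ?bmf_meanZ//; [|exact: bmfZ|exact: bmfZ].
  rewrite bmf_meanB ?mean_cst ?xi0 ?xiv ?subrr ?mulr0 ?addr0//.
    exact: bmf_sqr.
  exact: bmf_cst.
move: (stdn_cdf ((a - S w) / Num.sqrt (tau + v))) AB => c AB.
have bc : bmf (fun _ : T => c) by exact: bmf_cst.
have bHc := bmfB (bH w) bc.
have -> : \int[P]_w' stdn_cdf ((a - S w - xi w') / Num.sqrt tau) - c =
  \int[P]_w' (stdn_cdf ((a - S w - xi w') / Num.sqrt tau) - c
     - (A * xi w' + B * (xi w' ^+ 2 - v))).
  by rewrite (bmf_meanB P bHc bL) L0 subr0 (bmf_meanB P (bH w) bc) (mean_cst P c).
have bx3 : bmf (fun w' => `|xi w'| ^+ 3).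
  under eq_fun => w' do rewrite exprS.
  by apply: bmfM; [exact: bmf_norm|apply: bmf_sqr; exact: bmf_norm].
rewrite (le_trans (bmf_mean_norm P (bmfB bHc bL)))//.
apply: (@le_trans _ _ (\int[P]_w' (C * (M * xi w' ^+ 2 + v ^+ 2)))).
  apply: bmf_mean_le.
  - exact: (bmf_norm (bmfB bHc bL)).
  - by apply: bmfZ; apply: bmfD (bmf_cst _); apply: bmfZ; exact: bmf_sqr.
  - move=> w'; rewrite (le_trans (AB (xi w')))// ler_wpM2l// lerD2r exprS.
    by rewrite real_normK ?num_real// ler_wpM2r// sqr_ge0.
rewrite bmf_meanZ; last by apply: bmfD (bmf_cst _); apply: bmfZ; exact: bmf_sqr.
rewrite bmf_meanD ?mean_cst ?bmf_meanZ ?xiv//; try exact: bmf_sqr.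
- by apply: bmfZ; exact: bmf_sqr.
- exact: bmf_cst.
Qed.

(** Induction on the family: each summand removed from the sum is replaced by its
variance, added to the time parameter. *)
Lemma lindeberg_sum (I : choiceType) {d'} {T' : measurableType d'}
  (X : I -> {RV P >-> T'}) (f : I -> T' -> R) (v : I -> R) (M tau0 C : R) :
  independent_RVs X ->
  0 <= C -> heat_constant tau0 C ->
  (forall i, measurable_fun [set: T'] (f i)) ->
  (forall i x, `|f i x| <= M) ->
  (forall i, \int[P]_w f i (X i w) = 0) ->
  (forall i, \int[P]_w (f i (X i w) ^+ 2) = v i) ->
  forall (r : seq I) (a tau : R), uniq r -> tau0 <= tau ->
  `|\int[P]_w stdn_cdf ((a - \sum_(i <- r) f i (X i w)) / Num.sqrt tau)
    - stdn_cdf (a / Num.sqrt (tau + \sum_(i <- r) v i))|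
  <= C * \sum_(i <- r) (M * v i + v i ^+ 2).
Proof.
move=> indX C0 hC mf fM f0 fv r a.
have mfX i : measurable_fun [set: T] (fun w => f i (X i w)).
  by apply: (measurableT_comp (mf i)); exact: measurable_funP.
have bfX i : bmf (fun w => f i (X i w)) by split => //; exists M => w; exact: fM.
elim: r => [tau _ _|i r IH tau /= /andP[ir ur] tautau0].
  rewrite !big_nil mulr0 addr0.
  under eq_Rintegral => w _ do rewrite big_nil subr0.
  by rewrite mean_cst subrr normr0.
have vi0 : 0 <= v i by rewrite -fv Rintegral_ge0// => w _; exact: sqr_ge0.
rewrite !big_cons; under eq_Rintegral => w _ do rewrite big_cons.
have mS : measurable_fun [set: T] (fun w => \sum_(j <- r) f j (X j w)).
  by apply: measurable_sum => j; exact: mfX.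
have ind := independent_RVs_sum indX mf ir.
have h1 := lindeberg_step a C0 hC tautau0 (bfX i) mS ind (fun w => fM i (X i w)) (f0 i) (fv i).
have h2 := IH (tau + v i) ur (le_trans tautau0 _).
have {}h2 := h2 (_ : tau <= tau + v i); rewrite lerDl in h2.
have {}h2 := h2 vi0; rewrite -addrA in h2.
rewrite mulrDr (le_trans (ler_distD (\int[P]_w stdn_cdf
  ((a - \sum_(j <- r) f j (X j w)) / Num.sqrt (tau + v i))) _ _))//.
exact: lerD.
Qed.

End lindeberg.

(** * From smoothed to true distribution functions *)

Section normal_limit.
Context {R : realType}.

Definition limit_cdf (v x : R) : R := fine (centered_normal v `]-oo, x]%classic).

Lemma limit_cdfE (v x : R) : (centered_normal v `]-oo, x]%classic = (limit_cdf v x)%:E)%E.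
Proof. by rewrite /limit_cdf fineK// fin_num_measure. Qed.

Lemma limit_cdf_gt0 (v x : R) : 0 < v -> limit_cdf v x = stdn_cdf (x / Num.sqrt v).
Proof.
move=> v0; rewrite /limit_cdf /centered_normal (gt_eqF v0).
by rewrite -normal_cdf_scale ?sqrtr_gt0.
Qed.

Lemma limit_cdf0 (x : R) : limit_cdf 0 x = (0 <= x)%R%:R.
Proof.
rewrite /limit_cdf /centered_normal eqxx/= /dirac indicE/= mem_setE/= in_itv/=.
by [].
Qed.

Lemma stdn_cdf_ends (h e : R) : 0 < h -> 0 < e ->
  \forall s \near 0^'+, 1 - stdn_cdf (h / s) <= e /\ stdn_cdf (- h / s) <= e.
Proof.
move=> h0 e0.
have [cN cy] := normal_cdf_cvg (1 : R).
have hy : h / s @[s --> 0^'+] --> +oo.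
  apply/cvgryPge => A.
  have A1 : 0 < Num.max A 1 by rewrite lt_max ltr01 orbT.
  have hA : 0 < (Num.max A 1)^-1 * h by rewrite mulr_gt0// invr_gt0.
  near=> s.
  have s0 : 0 < s by near: s; exact: nbhs_right_gt.
  have : s <= (Num.max A 1)^-1 * h by near: s; exact: nbhs_right_le.
  rewrite ler_pdivlMl// ler_pdivlMr//; apply: le_trans.
  by rewrite ler_pM2r// le_max lexx.
have hNy : - h / s @[s --> 0^'+] --> -oo.
  by under eq_fun do rewrite mulNr; apply/cvgNrNy.
have := cvg_comp _ _ hy cy => /cvgrPdist_le /(_ e e0) H1.
have := cvg_comp _ _ hNy cN => /cvgrPdist_le /(_ e e0) H2.
near=> s; split.
  by apply: le_trans (ler_norm _) _; near: s; exact: H1.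
rewrite -[leLHS]opprK -[X in - X]add0r.
apply: le_trans (_ : `|0 - stdn_cdf (- h / s)| <= e).
  by rewrite -normrN ler_norm.
by near: s; exact: H2.
Unshelve. all: by end_near. Qed.

(** Smoothing the limit law with a Gaussian of small variance s^2 changes its
distribution function by little, up to a shift [h] of the argument that absorbs the
possible atom at 0 of the limit law. *)
Lemma limit_cdf_smooth (v x h e : R) : 0 <= v -> 0 < h -> 0 < e ->
  \forall s \near 0^'+,
    stdn_cdf (x / Num.sqrt (s ^+ 2 + v)) <= limit_cdf v (x + h) + e /\
    limit_cdf v (x - h) - e <= stdn_cdf (x / Num.sqrt (s ^+ 2 + v)).
Proof.
rewrite le_eqVlt => /predU1P[<-|v0] h0 e0.
  near=> s.
  have s0 : 0 < s by near: s; exact: nbhs_right_gt.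
  have [sy sN] : 1 - stdn_cdf (h / s) <= e /\ stdn_cdf (- h / s) <= e.
    by near: s; exact: stdn_cdf_ends.
  rewrite addr0 sqrtr_sqr gtr0_norm// !limit_cdf0.
  have /andP[p0 p1] := normal_cdf_bounds 1 (x / s).
  rewrite -/(stdn_cdf _) in p0 p1.
  split.
    case: (leP 0 (x + h)) => xh; first by rewrite (le_trans p1)// lerDl ltW.
    rewrite add0r (le_trans _ sN)//; apply: normal_cdf_nd.
    by rewrite ler_pM2r ?invr_gt0//; lra.
  case: (leP 0 (x - h)) => xh; last by rewrite sub0r (le_trans _ p0)// oppr_le0 ltW.
  rewrite lerBlDr -lerBlDl (le_trans _ sy)// lerB//.
  by apply: normal_cdf_nd; rewrite ler_pM2r ?invr_gt0//; lra.
have c : stdn_cdf (x / Num.sqrt (s ^+ 2 + v)) @[s --> 0^'+] --> limit_cdf v x.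
  rewrite limit_cdf_gt0//; apply: continuous_cvg; first exact: continuous_stdn_cdf.
  apply: cvgMr; apply: cvgV; first by rewrite gt_eqF ?sqrtr_gt0.
  apply: (@continuous_cvg _ _ _ _ _ _ Num.sqrt); first exact: sqrt_continuous.
  rewrite -[X in _ --> X]add0r; apply: cvgD; last exact: cvg_cst.
  rewrite -[X in _ --> X](expr0n R 2) ; apply: cvg_at_right_filter.
  exact: exprn_continuous.
move/cvgrPdist_le/(_ e e0) : c => H.
have nd y z : y <= z -> limit_cdf v y <= limit_cdf v z.
  move=> yz; rewrite !limit_cdf_gt0//; apply: normal_cdf_nd.
  by rewrite ler_pM2r ?invr_gt0 ?sqrtr_gt0.
near=> s.
have : `|limit_cdf v x - stdn_cdf (x / Num.sqrt (s ^+ 2 + v))| <= e by near: s.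
rewrite ler_distl => /andP[H1 H2].
have n1 : limit_cdf v x <= limit_cdf v (x + h) by apply: nd; rewrite lerDl ltW.
have n2 : limit_cdf v (x - h) <= limit_cdf v x by apply: nd; rewrite gerBl ltW.
by split; lra.
Unshelve. all: by end_near. Qed.

End normal_limit.

(** If y <= x then either w <= x + h, and the smoothed indicator at w is almost 1, or
w is at distance at least h from y.  The second inequality is symmetric. *)
Lemma smooth_indicator {R : realType} (x y w h s : R) : 0 < h -> 0 < s ->
  (y <= x)%R%:R <= stdn_cdf ((x + 2 * h - w) / s) + (1 - stdn_cdf (h / s))
    + h^-1 * `|y - w| /\
  stdn_cdf ((x - 2 * h - w) / s) <= (y <= x)%R%:R + stdn_cdf (- h / s)
    + h^-1 * `|y - w|.
Proof.
move=> h0 s0.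
have r0 : 0 <= h^-1 * `|y - w| by rewrite mulr_ge0// invr_ge0 ltW.
have bd (z : R) : 0 <= stdn_cdf z <= 1 by exact: normal_cdf_bounds.
have nd a b : a <= b -> stdn_cdf (a / s) <= stdn_cdf (b / s).
  by move=> ab; apply: normal_cdf_nd; rewrite ler_pM2r ?invr_gt0.
split.
  have /andP[p0 p1] := bd ((x + 2 * h - w) / s); have /andP[q0 q1] := bd (h / s).
  case: (leP y x) => yx; last by rewrite /=; lra.
  case: (leP w (x + h)) => wx.
    have := nd h (x + 2 * h - w) ltac:(lra); rewrite /=; lra.
  have : 1 <= h^-1 * `|y - w|.
    by rewrite ler_pdivlMl// mulr1 distrC (le_trans _ (ler_norm _))//; lra.
  rewrite /=; lra.
have /andP[p0 p1] := bd ((x - 2 * h - w) / s); have /andP[q0 q1] := bd (- h / s).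
case: (leP y x) => yx; first by rewrite /=; lra.
case: (leP w (x - h)) => wx; last first.
  have := nd (x - 2 * h - w) (- h) ltac:(lra); rewrite /=; lra.
have : 1 <= h^-1 * `|y - w|.
  by rewrite ler_pdivlMl// mulr1 (le_trans _ (ler_norm _))//; lra.
rewrite /=; lra.
Qed.

Lemma sandwich6 {R : realType} (e a a' b b' A B D y N l lr ll p : R) :
  `|a - a'| <= e / 6 -> `|b - b'| <= e / 6 ->
  `|0 - (A - a')| <= e / 6 -> `|0 - (B - b')| <= e / 6 -> D <= e / 6 ->
  1 - y <= e / 6 -> N <= e / 6 -> a <= lr + e / 6 -> ll - e / 6 <= b ->
  lr <= l + e / 6 -> l - e / 6 <= ll ->
  p <= A + (1 - y) + D -> B <= p + N + D -> `|l - p| <= e.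
Proof.
rewrite !sub0r !normrN !ler_norml.
move=> /andP[? ?] /andP[? ?] /andP[? ?] /andP[? ?] *.
by apply/andP; split; lra.
Qed.

Section convergence_in_distribution.
Context {d} {T : measurableType d} {R : realType} (P : probability T R).

(** The distribution function of [Y t] at [x] is squeezed between means of smoothed
indicators of [W t] at x - 2h and x + 2h ([smooth_indicator]), which are close to
values of the limit distribution function at distance at most 3h from [x]. *)
Lemma cvg_in_distribution_normal (Y W : nat -> T -> R) (V : nat -> R) (v : R) :
  (forall t, bmf (Y t)) -> (forall t, bmf (W t)) -> 0 <= v ->
  V t @[t --> \oo] --> v ->
  (forall a s, 0 < s ->
    \int[P]_w stdn_cdf ((a - W t w) / s) - stdn_cdf (a / Num.sqrt (s ^+ 2 + V t))
      @[t --> \oo] --> (0 : R)) ->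
  \int[P]_w `|Y t w - W t w| @[t --> \oo] --> (0 : R) ->
  cvg_in_distribution P Y (centered_normal v).
Proof.
move=> bY bW v0 Vv WV YW; split=> [t|x Fx]; first exact: (bY t).1.
have mY t : measurable [set w | Y t w <= x].
  rewrite -[X in measurable X]setTI.
  have -> : [set w | Y t w <= x] = Y t @^-1` `]-oo, x].
    by apply/seteqP; split=> w /=; rewrite in_itv.
  exact: (bY t).1.
have pE t : P [set w | Y t w <= x] = (fine (P [set w | Y t w <= x]))%:E.
  by rewrite fineK// fin_num_measure.
under eq_fun do rewrite pE.
rewrite limit_cdfE; apply: cvg_EFin; first by near=> t.
have {}Fx : limit_cdf v y @[y --> x] --> limit_cdf v x.
  by apply: fine_cvg; rewrite -limit_cdfE; exact: Fx.
apply/cvgrPdist_le => /= e e0.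
(* six error terms are added up in [sandwich6] *)
pose e1 := e / 6; have e10 : 0 < e1 by rewrite divr_gt0.
(* continuity of the limit distribution function at x enters here *)
have [h h0 [hl hr]] : exists2 h, 0 < h & limit_cdf v (x + 3 * h) <= limit_cdf v x + e1
    /\ limit_cdf v x - e1 <= limit_cdf v (x - 3 * h).
  move/cvgrPdist_le/(_ e1 e10) : Fx => -[r /= r0 hr].
  exists (r / 4); first by rewrite divr_gt0.
  have := hr (x + 3 * (r / 4)); have := hr (x - 3 * (r / 4)).
  rewrite /ball_ /= !ler_distl opprB addrCA subrr addr0 opprD addrA subrr add0r normrN.
  rewrite gtr0_norm ?mulr_gt0 ?divr_gt0//.
  move=> H1 H2; have r4 : 3 * (r / 4) < r by lra.
  have /andP[] := H1 r4; have /andP[] := H2 r4; lra.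
have [s [s0 [sy sN] su sl]] : exists s, [/\ 0 < s,
    1 - stdn_cdf (h / s) <= e1 /\ stdn_cdf (- h / s) <= e1,
    stdn_cdf ((x + 2 * h) / Num.sqrt (s ^+ 2 + v)) <= limit_cdf v (x + 2 * h + h) + e1 &
    limit_cdf v (x - 2 * h - h) - e1 <= stdn_cdf ((x - 2 * h) / Num.sqrt (s ^+ 2 + v))].
  have [s] : exists s, [/\ 0 < s,
    1 - stdn_cdf (h / s) <= e1 /\ stdn_cdf (- h / s) <= e1,
    (stdn_cdf ((x + 2 * h) / Num.sqrt (s ^+ 2 + v)) <= limit_cdf v (x + 2 * h + h) + e1 /\
    limit_cdf v (x + 2 * h - h) - e1 <= stdn_cdf ((x + 2 * h) / Num.sqrt (s ^+ 2 + v))) &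
    (stdn_cdf ((x - 2 * h) / Num.sqrt (s ^+ 2 + v)) <= limit_cdf v (x - 2 * h + h) + e1 /\
    limit_cdf v (x - 2 * h - h) - e1 <= stdn_cdf ((x - 2 * h) / Num.sqrt (s ^+ 2 + v)))].
    apply: (@filter_ex _ (0^'+)); near=> s; split.
    - by near: s; exact: nbhs_right_gt.
    - by near: s; exact: stdn_cdf_ends.
    - by near: s; exact: limit_cdf_smooth.
    - by near: s; exact: limit_cdf_smooth.
  by move=> [s0 ? [? _] [_ ?]]; exists s.
have cV a : stdn_cdf (a / Num.sqrt (s ^+ 2 + V t)) @[t --> \oo]
    --> stdn_cdf (a / Num.sqrt (s ^+ 2 + v)).
  apply: continuous_cvg; first exact: continuous_stdn_cdf.
  apply: cvgMr; apply: cvgV.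
    by rewrite gt_eqF// sqrtr_gt0 ltr_pwDl// exprn_gt0.
  apply: (@continuous_cvg _ _ _ _ _ _ Num.sqrt); first exact: sqrt_continuous.
  by apply: cvgD Vv; exact: cvg_cst.
have eh0 : 0 < e1 * h by rewrite mulr_gt0.
near=> t.
have V1 : `|stdn_cdf ((x + 2 * h) / Num.sqrt (s ^+ 2 + v)) -
    stdn_cdf ((x + 2 * h) / Num.sqrt (s ^+ 2 + V t))| <= e1.
  by near: t; move/cvgrPdist_le/(_ e1 e10) : (cV (x + 2 * h)).
have V2 : `|stdn_cdf ((x - 2 * h) / Num.sqrt (s ^+ 2 + v)) -
    stdn_cdf ((x - 2 * h) / Num.sqrt (s ^+ 2 + V t))| <= e1.
  by near: t; move/cvgrPdist_le/(_ e1 e10) : (cV (x - 2 * h)).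
have W1 : `|0 - (\int[P]_w stdn_cdf ((x + 2 * h - W t w) / s)
    - stdn_cdf ((x + 2 * h) / Num.sqrt (s ^+ 2 + V t)))| <= e1.
  by near: t; move/cvgrPdist_le/(_ e1 e10) : (WV (x + 2 * h) s s0).
have W2 : `|0 - (\int[P]_w stdn_cdf ((x - 2 * h - W t w) / s)
    - stdn_cdf ((x - 2 * h) / Num.sqrt (s ^+ 2 + V t)))| <= e1.
  by near: t; move/cvgrPdist_le/(_ e1 e10) : (WV (x - 2 * h) s s0).
have D1 : `|0 - \int[P]_w `|Y t w - W t w| | <= e1 * h.
  by near: t; move/cvgrPdist_le/(_ (e1 * h) eh0) : YW.
have bD : bmf (fun w => h^-1 * `|Y t w - W t w|).
  by apply: bmfZ; apply: bmf_norm; exact: bmfB.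
have {}D1 : \int[P]_w (h^-1 * `|Y t w - W t w|) <= e1.
  rewrite bmf_meanZ; last by apply: bmf_norm; exact: bmfB.
  rewrite mulrC ler_pdivrMr//; move: D1; rewrite sub0r normrN ger0_norm//.
  exact: Rintegral_ge0.
have bPhi a : bmf (fun w => stdn_cdf ((a - W t w) / s)).
  by apply: bmf_stdn_cdf_comp; apply: measurable_funB => //; exact: (bW t).1.
rewrite -mean_indic//.
have bI : bmf (\1_[set w | Y t w <= x] : T -> R) by exact: bmf_indic.
have bc c : bmf (fun _ : T => c : R) by exact: bmf_cst.
have IE w : \1_[set w | Y t w <= x] w = (Y t w <= x)%R%:R :> R.
  by rewrite indicE mem_setE.
have up : \int[P]_w \1_[set w | Y t w <= x] w <=
    \int[P]_w stdn_cdf ((x + 2 * h - W t w) / s) + (1 - stdn_cdf (h / s))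
    + \int[P]_w (h^-1 * `|Y t w - W t w|).
  rewrite -[X in _ <= _ + X + _](mean_cst P) -!bmf_meanD//; last exact: bmfD.
  apply: bmf_mean_le => //; first by apply: bmfD => //; exact: bmfD.
  by move=> w; rewrite IE; exact: (smooth_indicator x (Y t w) (W t w) h0 s0).1.
have lo : \int[P]_w stdn_cdf ((x - 2 * h - W t w) / s) <=
    \int[P]_w \1_[set w | Y t w <= x] w + stdn_cdf (- h / s)
    + \int[P]_w (h^-1 * `|Y t w - W t w|).
  rewrite -[X in _ <= _ + X + _](mean_cst P) -!bmf_meanD//; last exact: bmfD.
  apply: bmf_mean_le => //; first by apply: bmfD => //; exact: bmfD.
  by move=> w; rewrite IE; exact: (smooth_indicator x (Y t w) (W t w) h0 s0).2.
have x3 : x + 2 * h + h = x + 3 * h by ring.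
have x3' : x - 2 * h - h = x - 3 * h by ring.
rewrite x3 in su; rewrite x3' in sl.
exact: sandwich6 V1 V2 W1 W2 D1 sy sN su sl hl hr up lo.
Unshelve. all: by end_near. Qed.

End convergence_in_distribution.

(** * Centred features of the samples *)

Section rkhs_dot_theory.
Context {R : realType} {X : Type} (H : rkhs R X).
Implicit Types f g h : H.
Local Notation "<< f , g >>" := (rkhs_dot H f g) (format "<< f ,  g >>").

Lemma dotC f g : <<f, g>> = <<g, f>>.
Proof. by rewrite hermC/= expr0 mul1r. Qed.

Lemma dotDl f g h : <<f + g, h>> = <<f, h>> + <<g, h>>.
Proof. exact: linearDl. Qed.

Lemma dotDr f g h : <<h, f + g>> = <<h, f>> + <<h, g>>.
Proof. by rewrite dotC dotDl !(dotC h). Qed.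

Lemma dotZl a f g : <<a *: f, g>> = a * <<f, g>>.
Proof. exact: linearZl_LR. Qed.

Lemma dotZr a f g : <<f, a *: g>> = a * <<f, g>>.
Proof. by rewrite dotC dotZl dotC. Qed.

Lemma dotNl f g : <<- f, g>> = - <<f, g>>.
Proof. by rewrite -scaleN1r dotZl mulN1r. Qed.

Lemma dotNr f g : <<f, - g>> = - <<f, g>>.
Proof. by rewrite dotC dotNl dotC. Qed.

Lemma dotBl f g h : <<f - g, h>> = <<f, h>> - <<g, h>>.
Proof. by rewrite dotDl dotNl. Qed.

Lemma dotBr f g h : <<h, f - g>> = <<h, f>> - <<h, g>>.
Proof. by rewrite dotC dotBl !(dotC h). Qed.

Lemma dot0l f : <<0, f>> = 0.
Proof. by rewrite -(scale0r f) dotZl mul0r. Qed.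

Lemma dot_suml (I : Type) (r : seq I) (Q : pred I) (F : I -> H) f :
  <<\sum_(i <- r | Q i) F i, f>> = \sum_(i <- r | Q i) <<F i, f>>.
Proof.
by elim/big_ind2: _ => [|u a v b <- <-|//]; rewrite ?dot0l// dotDl.
Qed.

Lemma dot_sumr (I : Type) (r : seq I) (Q : pred I) (F : I -> H) f :
  <<f, \sum_(i <- r | Q i) F i>> = \sum_(i <- r | Q i) <<f, F i>>.
Proof. by rewrite dotC dot_suml; apply: eq_bigr => i _; rewrite dotC. Qed.

Lemma dot_ge0 f : 0 <= <<f, f>>.
Proof. by rewrite -rkhs_normE sqr_ge0. Qed.

(** Positivity of the squares of f + g and f - g; this form of the
Cauchy-Schwarz inequality suits estimates by sums of squared deviations. *)
Lemma dot_bound f g : 2 * `|<<f, g>>| <= <<f, f>> + <<g, g>>.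
Proof.
have := dot_ge0 (f + g); have := dot_ge0 (f - g).
rewrite !(dotDl, dotDr, dotNl, dotNr) (dotC g f).
by case: (ger0P <<f, g>>) => ? ? ?; lra.
Qed.

Lemma dot_addB_bound f g : <<f + g, f + g>> <= 2 * (<<f, f>> + <<g, g>>) /\
  <<f - g, f - g>> <= 2 * (<<f, f>> + <<g, g>>).
Proof.
have := dot_bound f g; rewrite !(dotDl, dotDr, dotNl, dotNr) (dotC g f).
have := ler_norm <<f, g>>; have := ler_norm (- <<f, g>>); rewrite normrN.
by move=> *; split; lra.
Qed.

Lemma rkhs_kernelE x y : rkhs_kernel H x y = <<rkhs_feature H x, rkhs_feature H y>>.
Proof. by rewrite rkhs_reproducing. Qed.

Lemma rkhs_kernel_bound B : (forall x y, rkhs_kernel H x y <= B) ->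
  forall x y, `|rkhs_kernel H x y| <= B.
Proof.
move=> KB x y; have := dot_bound (rkhs_feature H x) (rkhs_feature H y).
by rewrite -!rkhs_kernelE; have := KB x x; have := KB y y => ? ? ?; lra.
Qed.

End rkhs_dot_theory.

Section sample.
Context {R : realType} {X : pmetricType R} (H : rkhs R X) {s : nat}.
Context {d} {T : measurableType d} (P : probability T R).
Variable Xs : 'I_s -> nat -> {RV P >-> borel X}.
Variable PP : 'I_s -> probability (borel X) R.
Variable m : 'I_s -> H.
Variable B : R.
Hypothesis hlaw : forall (j : 'I_s) (i : nat) (A : set (borel X)), measurable A ->
  distribution P (Xs j i) A = PP j A.
Hypothesis hindep : independent_RVs (fun ji : 'I_s * nat => Xs ji.1 ji.2).
Hypothesis hm : forall j, is_mean_embedding P (Xs j 0%N) (m j).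
Hypothesis hKmeas : measurable_fun [set: borel X * borel X]
  (fun z : borel X * borel X => rkhs_kernel H z.1 z.2).
Hypothesis KB : forall x y, rkhs_kernel H x y <= B.
Local Notation "<< f , g >>" := (rkhs_dot H f g) (format "<< f ,  g >>").
Local Notation K_ := (rkhs_feature H).

Lemma mean_same_law j i (f : borel X -> R) : bmf f ->
  \int[P]_w f (Xs j i w) = \int[P]_w f (Xs j 0%N w).
Proof.
move=> bf.
have E k : \int[P]_w f (Xs j k w) = \int[PP j]_x f x.
  have mX : measurable_fun [set: T] (Xs j k) by exact: measurable_funP.
  congr fine.
  transitivity (\int[distribution P (Xs j k)]_x (f x)%:E)%E; last first.
    by apply: eq_measure_integral => A mA _; exact: hlaw.
  rewrite integral_distribution//; first by apply/measurable_EFinP; exact: bf.1.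
  exact: (bmf_integrable P (bmf_comp mX bf)).
by rewrite !E.
Qed.

Lemma bmf_kernel : bmf (fun z : borel X * borel X => rkhs_kernel H z.1 z.2).
Proof. by split => //; exists B => z; exact: rkhs_kernel_bound. Qed.

(** The elements of [H] that may be used as linear test functions: the weak
definition of a mean embedding prescribes the integrals of all elements, but
only at the first observation, and says nothing about measurability. *)
Definition testable (f : H) :=
  bmf (fun x : borel X => <<K_ x, f>>) /\
  forall j i, \int[P]_w <<K_ (Xs j i w), f>> = <<m j, f>>.

Lemma testable_bmf_embedding (f : H) : bmf (fun x : borel X => <<K_ x, f>>) -> testable f.
Proof.
move=> bf; split=> // j i; rewrite (mean_same_law j i bf).
have mX : measurable_fun [set: T] (Xs j 0%N) by exact: measurable_funP.
have := hm j f; rewrite (_ : _ \o _ = fun w => <<K_ (Xs j 0%N w), f>>).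
  by rewrite (bmf_expectation P (bmf_comp mX bf)) => -[].
by apply/funext => w /=; rewrite dotC rkhs_reproducing.
Qed.

Lemma testable_feature x : testable (K_ x).
Proof.
apply: testable_bmf_embedding.
under eq_fun => y do rewrite dotC -rkhs_kernelE.
exact: (bmf_section1 bmf_kernel x).
Qed.

(** By the definition of the embedding at a feature, <m_j, K(x, .)> is the integral
of K(x, y) against the law of the j-th sample, hence measurable in [x]. *)
Lemma testable_mean j : testable (m j).
Proof.
apply: testable_bmf_embedding.
have mX : measurable_fun [set: T] (Xs j 0%N) by exact: measurable_funP.
rewrite [X in bmf X](_ : _ = fun x => \int[P]_w rkhs_kernel H x (Xs j 0%N w)).
  apply: (@bmf_partial_mean _ _ (borel X) T R
    (fun z => rkhs_kernel H z.1 (Xs j 0%N z.2))).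
  apply: (bmf_comp (h := fun z : borel X * T => (z.1, Xs j 0%N z.2 : borel X)) _ bmf_kernel).
  apply: measurable_fun_pair => //.
  exact: (measurableT_comp mX).
apply/funext => x; rewrite dotC -((testable_feature x).2 j 0%N).
by apply: eq_Rintegral => w _; rewrite rkhs_kernelE dotC.
Qed.

Lemma testableD f g : testable f -> testable g -> testable (f + g).
Proof.
move=> [bf _] [bg _]; apply: testable_bmf_embedding.
by under eq_fun do rewrite dotDr; exact: bmfD.
Qed.

Lemma testableZ a f : testable f -> testable (a *: f).
Proof.
move=> [bf _]; apply: testable_bmf_embedding.
by under eq_fun do rewrite dotZr; exact: bmfZ.
Qed.

Lemma testableB f g : testable f -> testable g -> testable (f - g).
Proof. by move=> tf tg; rewrite -scaleN1r; apply: testableD => //; exact: testableZ. Qed.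

Lemma testable_sum (F : 'I_s -> H) : (forall l, testable (F l)) -> testable (\sum_l F l).
Proof.
move=> tF; elim/big_ind: _ => //; last exact: testableD.
apply: testable_bmf_embedding; under eq_fun do rewrite dotC dot0l.
exact: bmf_cst.
Qed.

Lemma bmf_centered j f : testable f -> bmf (fun x : borel X => <<K_ x - m j, f>>).
Proof.
move=> [bf _]; under eq_fun do rewrite dotBl.
by apply: bmfB => //; exact: bmf_cst.
Qed.

Lemma mean_centered j i f : testable f -> \int[P]_w <<K_ (Xs j i w) - m j, f>> = 0.
Proof.
move=> [bf Ef]; under eq_Rintegral do rewrite dotBl.
have mX : measurable_fun [set: T] (Xs j i) by exact: measurable_funP.
by rewrite (bmf_meanB P (bmf_comp mX bf) (bmf_cst _)) Ef mean_cst subrr.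
Qed.

Definition centered_kernel j (z : borel X * borel X) := <<K_ z.1 - m j, K_ z.2 - m j>>.

Lemma bmf_centered_kernel j : bmf (centered_kernel j).
Proof.
have [bm _] := testable_mean j.
rewrite [X in bmf X](_ : _ = fun z => rkhs_kernel H z.1 z.2 - <<K_ z.1, m j>>
    - (<<K_ z.2, m j>> - <<m j, m j>>)); last first.
  apply/funext => z.
  by rewrite /centered_kernel dotBl !dotBr -rkhs_kernelE (dotC (m j) (K_ z.2)).
apply: bmfB.
  by apply: bmfB; [exact: bmf_kernel|exact: (bmf_comp (h := fst) _ bm)].
by apply: bmfB; [exact: (bmf_comp (h := snd) _ bm)|exact: bmf_cst].
Qed.

(** Integrating first over one of the two independent observations, the other being
fixed, leaves the mean of a centred test function. *)
Lemma mean_centered_kernel j i p : i != p ->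
  \int[P]_w centered_kernel j (Xs j i w, Xs j p w) = 0.
Proof.
move=> ip.
have ind : indep_pair P (Xs j i) (Xs j p).
  apply: (independent_RVs_pair hindep (x := (j, i)) (y := (j, p))).
  by apply: contraNneq ip => -[->].
have mi : measurable_fun [set: T] (Xs j i) by exact: measurable_funP.
have mp : measurable_fun [set: T] (Xs j p) by exact: measurable_funP.
rewrite (indep_pair_mean mi mp ind (bmf_centered_kernel j)).
rewrite -[RHS](mean_cst P); apply: eq_Rintegral => w _; rewrite /centered_kernel/=.
under eq_Rintegral => w' _ do rewrite dotC.
apply: mean_centered; apply: testableB; [exact: testable_feature|exact: testable_mean].
Qed.

Definition weighted_dev j n (c : 'I_n -> R) (w : T) : H :=
  n%:R^-1 *: \sum_(i < n) c i *: (K_ (Xs j i w) - m j).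

Lemma weighted_dev_sqrE j n (c : 'I_n -> R) w : <<weighted_dev j c w, weighted_dev j c w>> =
  n%:R ^- 2 * \sum_(i < n) \sum_(p < n) c i * c p * centered_kernel j (Xs j i w, Xs j p w).
Proof.
rewrite /weighted_dev dotZl dotZr mulrA -expr2 -exprVn; congr (_ * _).
rewrite dot_suml; apply: eq_bigr => i _; rewrite dot_sumr; apply: eq_bigr => p _.
by rewrite dotZl dotZr mulrA.
Qed.

Lemma bmf_pair_centered j i p : bmf (fun w => centered_kernel j (Xs j i w, Xs j p w)).
Proof.
have mi : measurable_fun [set: T] (Xs j i) by exact: measurable_funP.
have mp : measurable_fun [set: T] (Xs j p) by exact: measurable_funP.
exact: (bmf_comp (measurable_fun_pair mi mp) (bmf_centered_kernel j)).
Qed.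

Lemma bmf_weighted_dev_sqr j n (c : 'I_n -> R) : bmf (fun w => <<weighted_dev j c w, weighted_dev j c w>>).
Proof.
under eq_fun do rewrite weighted_dev_sqrE.
apply: bmfZ; apply: bmf_sum => i _; apply: bmf_sum => p _.
by apply: bmfZ; exact: bmf_pair_centered.
Qed.

(** Only the diagonal terms of the double sum contribute. *)
Lemma mean_weighted_dev_sqr j n (c : 'I_n -> R) C : (0 < n)%N -> (forall i, `|c i| <= C) ->
  \int[P]_w <<weighted_dev j c w, weighted_dev j c w>> <= C ^+ 2 * (2 * (B + <<m j, m j>>)) / n%:R.
Proof.
move=> n0 cC; under eq_Rintegral do rewrite weighted_dev_sqrE.
have bik i p : bmf (fun w => c i * c p * centered_kernel j (Xs j i w, Xs j p w)).
  by apply: bmfZ; exact: bmf_pair_centered.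
rewrite bmf_meanZ; last by apply: bmf_sum => i _; apply: bmf_sum => p _.
rewrite bmf_mean_sum; last by move=> i _; apply: bmf_sum => p _.
set D := 2 * _.
have Ei (i : 'I_n) : \int[P]_w \sum_(p < n) c i * c p * centered_kernel j (Xs j i w, Xs j p w)
    <= C ^+ 2 * D.
  rewrite bmf_mean_sum// (bigD1 i)//= big1 ?addr0 => [|p pi]; last first.
    rewrite bmf_meanZ; last exact: bmf_pair_centered.
    by rewrite mean_centered_kernel ?mulr0// eq_sym.
  rewrite -[leRHS](mean_cst P); apply: bmf_mean_le => //; first exact: bmf_cst.
  move=> w; rewrite -expr2 -(real_normK (num_real (c i))) ler_pM ?sqr_ge0 ?dot_ge0//.
    by rewrite lerXn2r ?nnegrE// (le_trans _ (cC i)).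
  rewrite /centered_kernel/= (le_trans (dot_addB_bound _ _).2)// /D ler_wpM2l//.
  by rewrite lerD2r -rkhs_kernelE.
apply: (@le_trans _ _ (n%:R ^- 2 * \sum_(i < n) C ^+ 2 * D)).
  by rewrite ler_wpM2l ?invr_ge0 ?exprn_ge0// ler_sum.
rewrite sumr_const card_ord -mulr_natl le_eqVlt; apply/orP; left; apply/eqP.
by field; rewrite pnatr_eq0 -lt0n.
Qed.

End sample.

(** * Expansion of the estimator *)

Section decomposition.
Context {R : realType} {X : Type} (H : rkhs R X) {s : nat}.
Local Notation "<< f , g >>" := (rkhs_dot H f g) (format "<< f ,  g >>").
Variables (rho pi_ kap : 'I_s -> R) (m D E : 'I_s -> H).

(** The estimator in terms of the deviations: m + D and kap m + E are the plain and
the weighted empirical means of the features. *)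
Definition embedding_estimator : R :=
  \sum_j \sum_(l | l != j) pi_ l *
    (<<m j + D j, m j + D j>> + <<m l + D l, m l + D l>>
      - 2 * <<kap j *: m j + E j, m l + D l>>).

(** The (j, l) summand of the estimator is split into its limit, a part of first
order in the deviations, and a part [quad_term] of second order in the
deviations or of first order in the bias of the weights. *)
Definition lin_term j l : R :=
  2 * <<m j, D j>> + 2 * <<m l - m j, D l>> - 2 * <<E j, m l>>.

Definition quad_term j l : R :=
  <<D j, D j>> + <<D l, D l>> - 2 * <<E j, D l>>
  - 2 * (kap j - 1) * <<m j, m l + D l>>.

Lemma estimator_termE j l :
  <<m j + D j, m j + D j>> + <<m l + D l, m l + D l>>
      - 2 * <<kap j *: m j + E j, m l + D l>> =
  `|m j - m l| ^+ 2 + lin_term j l + quad_term j l.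
Proof.
rewrite rkhs_normE /lin_term /quad_term !(dotDl, dotDr, dotNl, dotNr, dotZl).
rewrite (dotC (D j) (m j)) (dotC (D l) (m l)) (dotC (m l) (m j)) (dotC (E j) (m l)).
ring.
Qed.

(** The elements of [H] whose inner products with centred features are U_j and V_j. *)
Definition lin_coef j : H :=
  (1 - 2 * rho j + s%:R * rho j) *: m j + rho j *: (m j - \sum_l m l).

Definition cross_coef j : H := (\sum_l rho l *: m l) - rho j *: m j.

(** The diagonal terms of the double sum are added and subtracted; on the full
square the weights rho sum to 1 and the two indices separate. *)
Lemma sum_lin_term : \sum_j rho j = 1 ->
  \sum_j \sum_(l | l != j) rho l * lin_term j l =
  2 * \sum_j (<<D j, lin_coef j>> - <<E j, cross_coef j>>).
Proof.
move=> rho1.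
have -> : \sum_j \sum_(l | l != j) rho l * lin_term j l =
    \sum_j \sum_l rho l * lin_term j l - \sum_j rho j * lin_term j j.
  rewrite -sumrB; apply: eq_bigr => j _.
  by rewrite [in RHS](bigD1 j)//= addrAC subrr add0r.
have -> : \sum_j \sum_l rho l * lin_term j l =
    \sum_j (2 * <<m j, D j>> - 2 * <<E j, \sum_l rho l *: m l>>)
    + \sum_l \sum_j rho l * (2 * <<m l - m j, D l>>).
  rewrite [in X in _ + X]exchange_big -big_split/=; apply: eq_bigr => j _.
  have -> : <<E j, \sum_l rho l *: m l>> = \sum_l rho l * <<E j, m l>>.
    by rewrite dot_sumr; apply: eq_bigr => l _; rewrite dotZr.
  have -> : 2 * <<m j, D j>> = \sum_l rho l * (2 * <<m j, D j>>).
    by rewrite -mulr_suml rho1 mul1r.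
  rewrite mulr_sumr -sumrB -big_split/=.
  by apply: eq_bigr => l _; rewrite /lin_term; ring.
rewrite -big_split -sumrB mulr_sumr; apply: eq_bigr => j _ /=.
rewrite -mulr_sumr -mulr_sumr -dot_suml sumrB sumr_const card_ord -(scaler_nat s (m j)).
rewrite /lin_term /lin_coef /cross_coef subrr dot0l mulr0 addr0.
rewrite !(dotDl, dotDr, dotNl, dotNr, dotZl, dotZr) (dotC (m j) (D j)).
rewrite (dotC (\sum_i m i) (D j)); ring.
Qed.

Hypothesis pi01 : forall l, 0 <= pi_ l <= 1.
Let Cm := \sum_l <<m l, m l>>.
Let Q := \sum_j (<<D j, D j>> + <<E j, E j>>).

Let CmE j : <<m j, m j>> <= Cm.
Proof. by rewrite /Cm (bigD1 j)//= lerDl sumr_ge0// => l _; exact: dot_ge0. Qed.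

Let QE j : <<D j, D j>> + <<E j, E j>> <= Q.
Proof.
by rewrite /Q (bigD1 j)//= lerDl sumr_ge0// => l _; rewrite addr_ge0 ?dot_ge0.
Qed.

Lemma norm_diff_bound j l : `|m j - m l| ^+ 2 <= 4 * Cm.
Proof.
rewrite rkhs_normE (le_trans (dot_addB_bound _ _).2)//.
by have := CmE j; have := CmE l => ? ?; lra.
Qed.

Lemma lin_term_bound j l : `|lin_term j l| <= 6 * Cm + 3 * Q.
Proof.
have b1 := dot_bound (m j) (D j).
have b2 := dot_bound (m l - m j) (D l).
have b3 := dot_bound (E j) (m l).
have b4 := norm_diff_bound l j; rewrite rkhs_normE in b4.
have c1 := CmE j; have c2 := CmE l; have q1 := QE j; have q2 := QE l.
have d1 := dot_ge0 (D j); have d2 := dot_ge0 (E j); have d3 := dot_ge0 (E l).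
have d4 := dot_ge0 (D l).
rewrite /lin_term (le_trans (ler_normB _ _))//.
rewrite (le_trans (lerD (ler_normD _ _) (lexx _)))// !normrM ger0_norm//.
move: b1 b2 b3 b4 c1 c2 q1 q2 d1 d2 d3 d4; set x := `|_|; set y := `|_|; set z := `|_|.
by move=> *; lra.
Qed.

Lemma quad_term_bound j l :
  `|quad_term j l| <= 4 * Q + `|kap j - 1| * (3 * Cm + 2 * Q).
Proof.
have b1 := dot_bound (E j) (D l).
have b2 := dot_bound (m j) (m l + D l).
have b4 := (dot_addB_bound (m l) (D l)).1.
have c1 := CmE j; have c2 := CmE l; have q1 := QE j; have q2 := QE l.
have d1 := dot_ge0 (D j); have d2 := dot_ge0 (E j); have d3 := dot_ge0 (E l).
have d4 := dot_ge0 (D l).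
rewrite /quad_term (le_trans (ler_normB _ _))// lerD//.
  rewrite (le_trans (ler_normB _ _))// ger0_norm ?addr_ge0// normrM ger0_norm//.
  by lra.
rewrite mulrAC mulrC normrM ler_wpM2l// normrM ger0_norm//.
by lra.
Qed.

(** The remainder is bounded by an affine function of the sum Q of all squared
deviations, with small coefficients, so that its mean only involves the mean of
Q. *)
Lemma estimator_expansion (N : R) : 0 <= N -> \sum_j rho j = 1 ->
  `|N * (embedding_estimator - \sum_j \sum_(l | l != j) rho l * `|m j - m l| ^+ 2)
    - N * (2 * \sum_j (<<D j, lin_coef j>> - <<E j, cross_coef j>>))|
  <= \sum_j \sum_l (N * `|pi_ l - rho l| * (10 * Cm + 3 * Q)
      + N * (4 * Q + `|kap j - 1| * (3 * Cm + 2 * Q))).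
Proof.
move=> N0 rho1; rewrite -sum_lin_term// -mulrBr normrM ger0_norm//.
have -> : embedding_estimator - \sum_j \sum_(l | l != j) rho l * `|m j - m l| ^+ 2
    - \sum_j \sum_(l | l != j) rho l * lin_term j l =
    \sum_j \sum_(l | l != j) ((pi_ l - rho l) * (`|m j - m l| ^+ 2 + lin_term j l)
      + pi_ l * quad_term j l).
  rewrite -!sumrB; apply: eq_bigr => j _; rewrite -!sumrB; apply: eq_bigr => l _.
  by rewrite estimator_termE; ring.
have C0 : 0 <= Cm by rewrite sumr_ge0// => l _; exact: dot_ge0.
have Q0 : 0 <= Q by rewrite sumr_ge0// => l _; rewrite addr_ge0 ?dot_ge0.
have bound0 j l : 0 <= N * `|pi_ l - rho l| * (10 * Cm + 3 * Q)
      + N * (4 * Q + `|kap j - 1| * (3 * Cm + 2 * Q)).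
  by rewrite addr_ge0 ?mulr_ge0 ?addr_ge0 ?mulr_ge0 ?addr_ge0 ?mulr_ge0.
apply: le_trans (ler_wpM2l N0 (ler_norm_sum _ _ _)) _.
rewrite mulr_sumr; apply: ler_sum => j _.
apply: le_trans (ler_wpM2l N0 (ler_norm_sum _ _ _)) _.
rewrite mulr_sumr big_mkcond/=; apply: ler_sum => l _; case: ifP => // _.
rewrite -mulrA -mulrDr ler_wpM2l// (le_trans (ler_normD _ _))// !normrM lerD//.
  rewrite ler_wpM2l// (le_trans (ler_normD _ _))// (ger0_norm (sqr_ge0 _)).
  have := norm_diff_bound j l; have := lin_term_bound j l => ? ?; lra.
have /andP[p0 p1] := pi01 l.
by rewrite (ger0_norm p0) -[leRHS]mul1r ler_pM// quad_term_bound.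
Qed.

End decomposition.

(** * Limits of the sample sizes, and the central limit theorem *)

Lemma cvg_finite_sum {R : realType} (I : Type) (r : seq I) (f : I -> nat -> R) (l : I -> R) :
  (forall i, f i t @[t --> \oo] --> l i) ->
  \sum_(i <- r) f i t @[t --> \oo] --> \sum_(i <- r) l i.
Proof.
move=> fl; elim: r => [|i r IH].
  rewrite big_nil (_ : (fun t => _) = fun=> 0); first exact: cvg_cst.
  by apply/funext => t; rewrite big_nil.
rewrite big_cons (_ : (fun t => _) = fun t => f i t + \sum_(j <- r) f j t).
  by apply: cvgD.
by apply/funext => t; rewrite big_cons.
Qed.

Lemma size_le_total {s} (n : 'I_s -> nat) j : (n j <= total_size n)%N.
Proof. by rewrite /total_size (bigD1 j)//= leq_addr. Qed.

Section sample_sizes.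
Context {R : realType} {s : nat}.
Variables (n : nat -> 'I_s -> nat) (rho : 'I_s -> R).
Hypothesis hn : forall j, n t j @[t --> \oo] --> \oo.
Hypothesis rho0 : forall j, 0 < rho j.
Hypothesis h2 : forall j, Num.sqrt (total_size (n t))%:R * (prop_size (n t) j - rho j)
  @[t --> \oo] --> (0 : R).
Local Notation N t := (total_size (n t))%:R.

Lemma near_size_ge j A : \forall t \near \oo, (A <= n t j)%N.
Proof. by have /cvgnyPge := hn j; apply. Qed.

Lemma inv_size_cvg j : ((n t j)%:R : R)^-1 @[t --> \oo] --> (0 : R).
Proof.
have := cvg_comp _ _ (hn j) (@cvgr_idn R).
move/gtr0_cvgV0; apply; near=> t.
by rewrite /= ltr0n; near: t; exact: near_size_ge.
Unshelve. all: by end_near. Qed.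

Lemma inv_sqrt_total_cvg : 'I_s -> (Num.sqrt (N t : R))^-1 @[t --> \oo] --> (0 : R).
Proof.
move=> j.
have c : (N t : R)^-1 @[t --> \oo] --> (0 : R).
  apply: (squeeze_cvgr _ (cvg_cst 0) (inv_size_cvg j)); near=> t.
  have nj : (0 < n t j)%N by near: t; exact: near_size_ge.
  rewrite invr_ge0 ler0n/= lef_pV2 ?posrE ?ltr0n ?ler_nat ?size_le_total//.
  by rewrite (leq_trans nj)// size_le_total.
rewrite (_ : (fun t => _) = fun t => Num.sqrt (N t : R)^-1); last first.
  by apply/funext => t; rewrite sqrtrV ?ler0n.
rewrite -[X in _ --> X](sqrtr0 R).
by apply: (@continuous_cvg _ _ _ _ _ _ Num.sqrt); first exact: sqrt_continuous.
Unshelve. all: by end_near. Qed.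

Lemma prop_size_cvg j : prop_size (n t) j @[t --> \oo] --> rho j.
Proof.
have c : (Num.sqrt (N t : R))^-1 * (Num.sqrt (N t) * (prop_size (n t) j - rho j))
    + rho j @[t --> \oo] --> rho j.
  rewrite -[X in _ --> X]add0r; apply: cvgD; last exact: cvg_cst.
  by rewrite -[X in _ --> X](mulr0 0); apply: cvgM (h2 j); exact: inv_sqrt_total_cvg.
apply: cvg_trans c.
apply: near_eq_cvg; near=> t.
have nj : (0 < n t j)%N by near: t; exact: near_size_ge.
have N0 : 0 < Num.sqrt (N t : R).
  by rewrite sqrtr_gt0 ltr0n (leq_trans nj)// size_le_total.
by rewrite /= mulrA mulVf ?gt_eqF// mul1r subrK.
Unshelve. all: by end_near. Qed.

Lemma total_ratio_cvg j : (N t : R) / (n t j)%:R @[t --> \oo] --> (rho j)^-1.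
Proof.
rewrite (_ : (fun t => _) = fun t => (prop_size (n t) j)^-1); last first.
  by apply/funext => t; rewrite /prop_size invf_div.
by apply: cvgV; [rewrite gt_eqF|exact: prop_size_cvg].
Qed.

(** sqrt n / n_j = (n / n_j) / sqrt n, and n / n_j has a finite limit. *)
Lemma sqrt_ratio_cvg j : Num.sqrt (N t : R) / (n t j)%:R @[t --> \oo] --> (0 : R).
Proof.
rewrite -[X in _ --> X](mulr0 (rho j)^-1).
rewrite [X in X @ _](_ : _ = fun t => (N t : R) / (n t j)%:R * (Num.sqrt (N t : R))^-1).
  by apply: cvgM; [exact: total_ratio_cvg|exact: inv_sqrt_total_cvg].
apply/funext => t; rewrite -[X in X / _ * _](sqr_sqrtr (ler0n R _)).
have [->|N0] := eqVneq (Num.sqrt (N t : R)) 0; first by rewrite invr0 mul0r mulr0.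
by rewrite mulrAC expr2 mulfK.
Qed.

End sample_sizes.

Definition sample_index {s : nat} (n : 'I_s -> nat) : seq ('I_s * nat) :=
  [seq (j, i) | j <- enum 'I_s, i <- iota 0 (n j)].

Lemma sample_index_uniq {s} (n : 'I_s -> nat) : uniq (sample_index n).
Proof.
apply: allpairs_uniq_dep; [exact: enum_uniq|by move=> j _; exact: iota_uniq|].
by move=> [j i] [j' i'] _ _ /= [-> ->].
Qed.

Lemma sum_sample_index {R : realType} {s} (n : 'I_s -> nat) (F : 'I_s * nat -> R) :
  \sum_(c <- sample_index n) F c = \sum_j \sum_(i < n j) F (j, i : nat).
Proof.
rewrite /sample_index big_allpairs_dep big_enum/=; apply: eq_bigr => j _.
by rewrite -(big_mkord xpredT (fun i => F (j, i))) /index_iota subn0.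
Qed.

Section lindeberg_limit.
Context {d d'} {T : measurableType d} {T' : measurableType d'} {R : realType}
  (P : probability T R) (I : choiceType) (X : I -> {RV P >-> T'}).

(** The error of the replacement method is at most a constant times (M + M^2) V: the
variances are bounded by M^2. *)
Lemma lindeberg_cvg (f : nat -> I -> T' -> R) (v : nat -> I -> R) (M : nat -> R)
  (r : nat -> seq I) (V : R) :
  independent_RVs X ->
  (forall t i, measurable_fun [set: T'] (f t i)) ->
  (forall t i x, `|f t i x| <= M t) ->
  (forall t i, \int[P]_w f t i (X i w) = 0) ->
  (forall t i, \int[P]_w (f t i (X i w) ^+ 2) = v t i) ->
  (forall t, uniq (r t)) ->
  M t @[t --> \oo] --> (0 : R) ->
  \sum_(i <- r t) v t i @[t --> \oo] --> V ->
  forall a s, 0 < s ->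
    \int[P]_w stdn_cdf ((a - \sum_(i <- r t) f t i (X i w)) / s)
      - stdn_cdf (a / Num.sqrt (s ^+ 2 + \sum_(i <- r t) v t i))
      @[t --> \oo] --> (0 : R).
Proof.
move=> indX mf fM f0 fv ur M0 vV a s s0.
have s20 : 0 < s ^+ 2 by rewrite exprn_gt0.
have [C C0 hC] := @heat_step R _ s20.
(* the error bound of [lindeberg_sum] for the initial time s^2 *)
pose b t := C * ((M t + M t * M t) * \sum_(i <- r t) v t i).
have b0 : b t @[t --> \oo] --> (0 : R).
  have M2 : M t * M t @[t --> \oo] --> (0 : R).
    rewrite -[X in _ --> X](mulr0 (0 : R)).
    exact: cvgM.
  rewrite -[X in _ --> X](mulr0 C); apply: cvgM; first exact: cvg_cst.
  by rewrite -[X in _ --> X](mul0r V) -[X in X * _](addr0 0); apply: cvgM vV; exact: cvgD.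
have ub t : `|\int[P]_w stdn_cdf ((a - \sum_(i <- r t) f t i (X i w)) / s)
      - stdn_cdf (a / Num.sqrt (s ^+ 2 + \sum_(i <- r t) v t i))| <= b t.
  have bfX i : bmf (fun w => f t i (X i w)).
    split; last by exists (M t) => w; exact: fM.
    by apply: (measurableT_comp (mf t i)); exact: measurable_funP.
  have := lindeberg_sum indX C0 hC (mf t) (fM t) (f0 t) (fv t) a (ur t) (lexx _).
  rewrite sqrtr_sqr (gtr0_norm s0) => /le_trans; apply; rewrite ler_wpM2l//.
  rewrite mulr_sumr ler_sum// => i _; rewrite mulrDl lerD// expr2.
  have v0 : 0 <= v t i by rewrite -fv Rintegral_ge0// => w _; exact: sqr_ge0.
  rewrite ler_wpM2r// -expr2 -fv -[leRHS](mean_cst P); apply: bmf_mean_le.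
  - exact: bmf_sqr.
  - exact: bmf_cst.
  - by move=> w; rewrite -(real_normK (num_real (f t i _))) lerXn2r ?nnegrE// (le_trans _ (fM t i (X i w))).
apply/cvgr0Pnorm_le => e e0; near=> t; apply: le_trans (ub t) _.
apply: le_trans (ler_norm _) _; near: t.
by move/cvgr0Pnorm_le : b0; apply.
Unshelve. all: by end_near. Qed.

End lindeberg_limit.

(** * The linear part of the estimator *)

Lemma mean_affine {d} {T : measurableType d} {R : realType} (P : probability T R)
  (a b : R) (f : T -> R) : bmf f -> \int[P]_w (a + b * f w) = a + b * \int[P]_w f w.
Proof.
by move=> bf; rewrite bmf_meanD ?mean_cst ?bmf_meanZ//; [exact: bmf_cst|exact: bmfZ].
Qed.

Section gmmd_asymptotics.
Context {R : realType} {X : pmetricType R} (H : rkhs R X) {s : nat}.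
Context {d} {T : measurableType d} (P : probability T R).
Variable Xs : 'I_s -> nat -> {RV P >-> borel X}.
Variable PP : 'I_s -> probability (borel X) R.
Variable m : 'I_s -> H.
Variable B : R.
Hypothesis hlaw : forall (j : 'I_s) (i : nat) (A : set (borel X)), measurable A ->
  distribution P (Xs j i) A = PP j A.
Hypothesis hindep : independent_RVs (fun ji : 'I_s * nat => Xs ji.1 ji.2).
Hypothesis hm : forall j, is_mean_embedding P (Xs j 0%N) (m j).
Hypothesis hKmeas : measurable_fun [set: borel X * borel X]
  (fun z : borel X * borel X => rkhs_kernel H z.1 z.2).
Hypothesis KB : forall x y, rkhs_kernel H x y <= B.
Variables (rho : 'I_s -> R) (gamma : R) (k : forall r, 'I_r -> R -> R) (Ck : R).
Arguments k : clear implicits.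
Hypothesis kC : forall r (i : 'I_r), `|k r i gamma| <= Ck.
Local Notation "<< f , g >>" := (rkhs_dot H f g) (format "<< f ,  g >>").
Local Notation K_ := (rkhs_feature H).

(** For unit weights, the coefficient of the embedding on the left is 1 as soon as
the sample is nonempty. *)
Lemma weighted_dev_uncenter j n (c : 'I_n -> R) w :
  (n%:R^-1 * \sum_i c i) *: m j + weighted_dev Xs m j c w =
  n%:R^-1 *: \sum_i c i *: K_ (Xs j i w).
Proof.
rewrite /weighted_dev -scalerA -scalerDr scaler_suml -big_split/=; congr (_ *: _).
by apply: eq_bigr => i _; rewrite -scalerDr addrC subrK.
Qed.

Lemma dot_sums (I J : Type) (r1 : seq I) (r2 : seq J) (a b : R) (c : I -> R) (e : J -> R)
  (F : I -> H) (G : J -> H) :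
  <<a *: \sum_(i <- r1) c i *: F i, b *: \sum_(p <- r2) e p *: G p>> =
  a * b * \sum_(i <- r1) \sum_(p <- r2) c i * e p * <<F i, G p>>.
Proof.
rewrite dotZl dotZr mulrA; congr (_ * _); rewrite dot_suml; apply: eq_bigr => i _.
by rewrite dot_sumr; apply: eq_bigr => p _; rewrite dotZl dotZr mulrA.
Qed.

Definition weight_mean (n : 'I_s -> nat) j : R :=
  (n j)%:R^-1 * \sum_(i < n j) k (n j) i gamma.

Definition dev (n : 'I_s -> nat) w j : H := weighted_dev Xs m j (fun _ : 'I_(n j) => 1) w.

Definition wdev (n : 'I_s -> nat) w j : H :=
  weighted_dev Xs m j (fun i : 'I_(n j) => k (n j) i gamma) w.

Lemma gmmd2_estimatorE (n : 'I_s -> nat) w : (forall j, (0 < n j)%N) ->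
  gmmd2_estimator H k gamma n (fun j i => Xs j i w) =
  embedding_estimator (prop_size n) (weight_mean n) m (dev n w) (wdev n w).
Proof.
move=> n0.
have ME j : m j + dev n w j = (n j)%:R^-1 *: \sum_(i < n j) (1 : R) *: K_ (Xs j i w).
  rewrite -(weighted_dev_uncenter j (fun _ : 'I_(n j) => 1)) sumr_const card_ord mulVf ?scale1r//.
  by rewrite pnatr_eq0 -lt0n.
have WE j : weight_mean n j *: m j + wdev n w j =
    (n j)%:R^-1 *: \sum_(i < n j) k (n j) i gamma *: K_ (Xs j i w).
  exact: (weighted_dev_uncenter j (fun i : 'I_(n j) => k (n j) i gamma)).
have sq j : <<m j + dev n w j, m j + dev n w j>> = (n j)%:R ^- 2 *
    (\sum_(i < n j) \sum_(p < n j) rkhs_kernel H (Xs j i w) (Xs j p w)).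
  rewrite ME dot_sums -expr2 exprVn; congr (_ * _).
  by apply: eq_bigr => i _; apply: eq_bigr => p _; rewrite !mul1r rkhs_kernelE.
apply: eq_bigr => j _; apply: eq_bigr => l _; congr (_ * _); rewrite !sq.
congr (_ - _); rewrite WE ME dot_sums invfM -!mulrA; congr (_ * (_ * (_ * _))).
by apply: eq_bigr => i _; apply: eq_bigr => p _; rewrite mulr1 rkhs_kernelE.
Qed.

Lemma bmf_estimator (n : 'I_s -> nat) :
  bmf (fun w => gmmd2_estimator H k gamma n (fun j i => Xs j i w)).
Proof.
have bK j i l p : bmf (fun w => rkhs_kernel H (Xs j i w) (Xs l p w)).
  have m1 : measurable_fun [set: T] (Xs j i) by exact: measurable_funP.
  have m2 : measurable_fun [set: T] (Xs l p) by exact: measurable_funP.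
  exact: (bmf_comp (measurable_fun_pair m1 m2) (bmf_kernel hKmeas KB)).
apply: bmf_sum => j _; apply: bmf_sum => l _; apply: bmfZ; apply: bmfB.
  by apply: bmfD; apply: bmfZ; apply: bmf_sum => i _; apply: bmf_sum => p _.
by apply: bmfZ; apply: bmf_sum => i _; apply: bmf_sum => p _; exact: bmfZ.
Qed.

Lemma testable_lin_coef j : testable Xs m (lin_coef rho m j).
Proof.
have tm := testable_mean hlaw hm hKmeas KB.
apply: (testableD hlaw hm); apply: (testableZ hlaw hm) => //.
by apply: (testableB hlaw hm) => //; exact: (testable_sum hlaw hm).
Qed.

Lemma testable_cross_coef j : testable Xs m (cross_coef rho m j).
Proof.
have tm := testable_mean hlaw hm hKmeas KB.
apply: (testableB hlaw hm); last exact: (testableZ hlaw hm).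
by apply: (testable_sum hlaw hm) => l; exact: (testableZ hlaw hm).
Qed.

Let U j : borel X -> R := Ufun rho m j.
Let V j : borel X -> R := Vfun rho m j.

Lemma bmf_Ufun j : bmf (U j).
Proof. exact: bmf_centered (testable_lin_coef j). Qed.

Lemma bmf_Vfun j : bmf (V j).
Proof. exact: bmf_centered (testable_cross_coef j). Qed.

Lemma mean_Ufun j i : \int[P]_w U j (Xs j i w) = 0.
Proof. exact: mean_centered (testable_lin_coef j). Qed.

Lemma mean_Vfun j i : \int[P]_w V j (Xs j i w) = 0.
Proof. exact: mean_centered (testable_cross_coef j). Qed.

Definition varU j := \int[P]_w (U j (Xs j 0%N w) ^+ 2).
Definition varV j := \int[P]_w (V j (Xs j 0%N w) ^+ 2).
Definition covUV j := \int[P]_w (U j (Xs j 0%N w) * V j (Xs j 0%N w)).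

Lemma covariance_centered (f g : T -> R) : bmf f -> bmf g ->
  \int[P]_w f w = 0 -> \int[P]_w g w = 0 ->
  fine (covariance P f g) = \int[P]_w (f w * g w).
Proof.
move=> bf bg f0 g0; rewrite unlock !bmf_expectation//= f0 g0.
  by apply: eq_Rintegral => w _ /=; rewrite !fctE/= !subr0.
rewrite (_ : _ * _ = fun w => f w * g w); first exact: bmfM.
by apply/funext => w /=; rewrite !fctE/= !subr0.
Qed.

Lemma asymptotic_varianceE k2 :
  asymptotic_variance P (fun j => Xs j 0%N : T -> X) rho m k2 =
  \sum_j 4 * (rho j)^-1 * (varU j - 2 * covUV j + k2 * varV j).
Proof.
apply: eq_bigr => j _; congr (_ * _).
have mX : measurable_fun [set: T] (Xs j 0%N) by exact: measurable_funP.
have bU := bmf_comp mX (bmf_Ufun j); have bV := bmf_comp mX (bmf_Vfun j).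
have U0 := mean_Ufun j 0; have V0 := mean_Vfun j 0.
rewrite /variance !covariance_centered// /varU /varV /covUV /U /V /=.
under eq_Rintegral do rewrite -expr2.
rewrite addrAC; congr (_ + _ * _).
Qed.

(** Up to a positive factor, the contribution of each sample is
Var(U - V) + (k2 - 1) Var V. *)
Lemma asymptotic_variance_ge0 k2 : (forall j, 0 < rho j) -> 1 <= k2 ->
  0 <= asymptotic_variance P (fun j => Xs j 0%N : T -> X) rho m k2.
Proof.
move=> rho0 k21; rewrite asymptotic_varianceE; apply: sumr_ge0 => j _.
rewrite mulr_ge0 ?mulr_ge0 ?invr_ge0 ?(ltW (rho0 j))//.
have mX : measurable_fun [set: T] (Xs j 0%N) by exact: measurable_funP.
have bU := bmf_comp mX (bmf_Ufun j); have bV := bmf_comp mX (bmf_Vfun j).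
have v0 : 0 <= varV j by apply: Rintegral_ge0 => w _; exact: sqr_ge0.
have : 0 <= \int[P]_w ((U j (Xs j 0%N w) - V j (Xs j 0%N w)) ^+ 2).
  by apply: Rintegral_ge0 => w _; exact: sqr_ge0.
have -> : \int[P]_w ((U j (Xs j 0%N w) - V j (Xs j 0%N w)) ^+ 2) =
    \int[P]_w ((U j (Xs j 0%N w) ^+ 2 + V j (Xs j 0%N w) ^+ 2)
      - 2 * (U j (Xs j 0%N w) * V j (Xs j 0%N w))).
  by apply: eq_Rintegral => w _; rewrite sqrrB mulr_natl addrAC.
rewrite (bmf_meanB P (bmfD (bmf_sqr bU) (bmf_sqr bV)) (bmfZ 2 (bmfM bU bV))).
rewrite (bmf_meanD P (bmf_sqr bU) (bmf_sqr bV)) (bmf_meanZ P 2 (bmfM bU bV)).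
rewrite -/(varU j) -/(varV j) -/(covUV j) => h.
have : 0 <= (k2 - 1) * varV j by rewrite mulr_ge0 ?subr_ge0.
by rewrite mulrBl mul1r; lra.
Qed.

(** Extension of the weights by 0 to all natural numbers, so that the summands of
all sample sizes are indexed by the same set of observations. *)
Definition weight r i : R := oapp (fun i' : 'I_r => k r i' gamma) 0 (insub i).

Lemma weight_ord r (i : 'I_r) : weight r i = k r i gamma.
Proof. by rewrite /weight valK. Qed.

Lemma weight_bound r i : `|weight r i| <= Ck + `|Ck|.
Proof.
rewrite /weight; case: insub => [i'|] /=; first by rewrite (le_trans (kC i'))// lerDl.
by rewrite normr0 -lerBlDl sub0r -normrN ler_norm.
Qed.

(** The contribution of one observation to sqrt n times the linear part. *)
Definition summand (n : 'I_s -> nat) (c : 'I_s * nat) (x : borel X) : R :=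
  Num.sqrt (total_size n)%:R * (2 / (n c.1)%:R) * (U c.1 x - weight (n c.1) c.2 * V c.1 x).

Lemma bmf_UV j a : bmf (fun x => U j x - a * V j x).
Proof. by apply: bmfB (bmfZ a (bmf_Vfun j)); exact: bmf_Ufun. Qed.

Lemma sum_summand (n : 'I_s -> nat) w :
  \sum_(c <- sample_index n) summand n c (Xs c.1 c.2 w) =
  Num.sqrt (total_size n)%:R *
    (2 * \sum_j (<<dev n w j, lin_coef rho m j>> - <<wdev n w j, cross_coef rho m j>>)).
Proof.
rewrite sum_sample_index mulr_sumr mulr_sumr; apply: eq_bigr => j _.
rewrite /dev /wdev /weighted_dev !dotZl !dot_suml -mulrBr -sumrB.
rewrite !mulr_sumr; apply: eq_bigr => i _.
by rewrite /summand/= weight_ord !dotZl mul1r /U /V /Ufun /Vfun -!mulrA.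
Qed.

Lemma mean_summand n c : \int[P]_w summand n c (Xs c.1 c.2 w) = 0.
Proof.
have mX : measurable_fun [set: T] (Xs c.1 c.2) by exact: measurable_funP.
have bU := bmf_comp mX (bmf_Ufun c.1); have bV := bmf_comp mX (bmf_Vfun c.1).
rewrite /summand bmf_meanZ; last exact: bmfB bU (bmfZ _ bV).
rewrite (bmf_meanB P bU (bmfZ _ bV)) (bmf_meanZ P _ bV).
by rewrite mean_Ufun mean_Vfun mulr0 subrr mulr0.
Qed.

Lemma mean_summand_sqr n c : \int[P]_w (summand n c (Xs c.1 c.2 w) ^+ 2) =
  (total_size n)%:R * (2 / (n c.1)%:R) ^+ 2 *
  (varU c.1 - 2 * weight (n c.1) c.2 * covUV c.1 + weight (n c.1) c.2 ^+ 2 * varV c.1).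
Proof.
set j := c.1; set a := weight _ _; set N := (total_size n)%:R.
have mX : measurable_fun [set: T] (Xs j 0%N) by exact: measurable_funP.
have bU := bmf_comp mX (bmf_Ufun j); have bV := bmf_comp mX (bmf_Vfun j).
have bs : bmf (fun x => summand n c x ^+ 2).
  by apply: bmf_sqr; apply: bmfZ; exact: bmf_UV.
rewrite (mean_same_law hlaw j c.2 bs).
rewrite (_ : \int[P]_w _ = \int[P]_w ((N * (2 / (n j)%:R) ^+ 2) *
    (U j (Xs j 0%N w) ^+ 2 - (2 * a) * (U j (Xs j 0%N w) * V j (Xs j 0%N w))
      + a ^+ 2 * V j (Xs j 0%N w) ^+ 2))); last first.
  apply: eq_Rintegral => w _; rewrite /summand -/j -/a !exprMn sqr_sqrtr ?ler0n//.
  by congr (_ * _); ring.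
have bU2 := bmf_sqr bU; have bV2 := bmfZ (a ^+ 2) (bmf_sqr bV).
have bUV := bmfZ (2 * a) (bmfM bU bV).
rewrite (bmf_meanZ P _ (bmfD (bmfB bU2 bUV) bV2)) (bmf_meanD P (bmfB bU2 bUV) bV2).
by rewrite (bmf_meanB P bU2 bUV) (bmf_meanZ P _ (bmf_sqr bV)) (bmf_meanZ P _ (bmfM bU bV)).
Qed.

Definition weight_sqr_mean (n : 'I_s -> nat) j : R :=
  (n j)%:R^-1 * \sum_(i < n j) k (n j) i gamma ^+ 2.

Lemma sum_mean_summand_sqr n :
  \sum_(c <- sample_index n) \int[P]_w (summand n c (Xs c.1 c.2 w) ^+ 2) =
  \sum_j 4 * ((total_size n)%:R / (n j)%:R) *
    (varU j - 2 * weight_mean n j * covUV j + weight_sqr_mean n j * varV j).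
Proof.
rewrite sum_sample_index; apply: eq_bigr => j _.
under eq_bigr => i _ do rewrite mean_summand_sqr/= weight_ord.
rewrite -mulr_sumr big_split/= sumrB -!mulr_suml -mulr_sumr sumr_const card_ord.
rewrite /weight_mean /weight_sqr_mean -(mulr_natl (varU j)).
have [n0|n0] := eqVneq ((n j)%:R : R) 0.
  by rewrite n0 invr0 !mulr0 expr0n/= mulr0 !mul0r.
by field.
Qed.

End gmmd_asymptotics.

(** * The remainder *)

Section remainder.
Context {R : realType} {X : pmetricType R} (H : rkhs R X) {s : nat}.
Context {d} {T : measurableType d} (P : probability T R).
Variable Xs : 'I_s -> nat -> {RV P >-> borel X}.
Variable PP : 'I_s -> probability (borel X) R.
Variable m : 'I_s -> H.
Variable B : R.
Hypothesis hlaw : forall (j : 'I_s) (i : nat) (A : set (borel X)), measurable A ->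
  distribution P (Xs j i) A = PP j A.
Hypothesis hindep : independent_RVs (fun ji : 'I_s * nat => Xs ji.1 ji.2).
Hypothesis hm : forall j, is_mean_embedding P (Xs j 0%N) (m j).
Hypothesis hKmeas : measurable_fun [set: borel X * borel X]
  (fun z : borel X * borel X => rkhs_kernel H z.1 z.2).
Hypothesis KB : forall x y, rkhs_kernel H x y <= B.
Variables (rho : 'I_s -> R) (gamma : R) (k : forall r, 'I_r -> R -> R) (Ck : R).
Arguments k : clear implicits.
Hypothesis kC : forall r (i : 'I_r), `|k r i gamma| <= Ck.
Local Notation "<< f , g >>" := (rkhs_dot H f g) (format "<< f ,  g >>").
Local Notation K_ := (rkhs_feature H).


Definition sqr_dev_bound (n : 'I_s -> nat) : R :=
  \sum_j (1 + Ck ^+ 2) * (2 * (B + <<m j, m j>>)) / (n j)%:R.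

Local Notation dev := (dev Xs m).
Local Notation wdev := (wdev Xs m gamma k).

Lemma bmf_sqr_dev (n : 'I_s -> nat) :
  bmf (fun w => \sum_j (<<dev n w j, dev n w j>> + <<wdev n w j, wdev n w j>>)).
Proof.
by apply: bmf_sum => j _; apply: bmfD; exact: (bmf_weighted_dev_sqr hlaw hm hKmeas KB).
Qed.

Lemma mean_sqr_dev (n : 'I_s -> nat) : (forall j, (0 < n j)%N) ->
  \int[P]_w (\sum_j (<<dev n w j, dev n w j>> + <<wdev n w j, wdev n w j>>))
  <= sqr_dev_bound n.
Proof.
move=> n0.
have b j (c : 'I_(n j) -> R) : bmf (fun w => <<weighted_dev Xs m j c w, weighted_dev Xs m j c w>>).
  exact: (bmf_weighted_dev_sqr hlaw hm hKmeas KB).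
rewrite bmf_mean_sum => [|j _]; last by apply: bmfD; exact: b.
apply: ler_sum => j _; rewrite bmf_meanD//; try exact: b.
have bd := mean_weighted_dev_sqr hlaw hindep hm hKmeas KB j (n0 j).
have h1 := bd (fun=> 1) 1 (fun=> _); rewrite normr1 expr1n in h1.
have h2 := bd (fun i : 'I_(n j) => k (n j) i gamma) Ck (fun i => kC i).
apply: le_trans (lerD (h1 (fun=> lexx _)) h2) _.
by rewrite -mulrDl -mulrDl.
Qed.

Lemma prop_size_itv (n : 'I_s -> nat) l : 0 <= (prop_size n l : R) <= 1.
Proof.
rewrite /prop_size divr_ge0//=; have [t0|t0] := eqVneq (total_size n) 0%N.
  by rewrite t0 invr0 mulr0.
by rewrite ler_pdivrMr ?ltr0n ?lt0n// mul1r ler_nat size_le_total.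
Qed.

(** Each deviation has mean square O(1/n_j), so the affine bound of
[estimator_expansion] integrates to a deterministic one. *)
Lemma mean_remainder (n : 'I_s -> nat) : (forall j, (0 < n j)%N) -> \sum_j rho j = 1 ->
  \int[P]_w `|Num.sqrt (total_size n)%:R *
      (gmmd2_estimator H k gamma n (fun j i => Xs j i w) - gmmd2 rho m)
    - \sum_(c <- sample_index n) summand m rho gamma k n c (Xs c.1 c.2 w)|
  <= \sum_j \sum_l
    (Num.sqrt (total_size n)%:R * `|prop_size n l - rho l|
       * (10 * (\sum_l <<m l, m l>>) + 3 * sqr_dev_bound n)
    + Num.sqrt (total_size n)%:R * (4 * sqr_dev_bound n +
       `|weight_mean gamma k n j - 1| * (3 * (\sum_l <<m l, m l>>) + 2 * sqr_dev_bound n))).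
Proof.
move=> n0 rho1; set N := Num.sqrt _; set Cm := \sum_l <<m l, m l>>; set q := sqr_dev_bound n.
have N0 : 0 <= N by exact: sqrtr_ge0.
pose Q w := \sum_j (<<dev n w j, dev n w j>> + <<wdev n w j, wdev n w j>>).
have bQ : bmf Q by exact: bmf_sqr_dev.
(* the bound as an affine function A + C Q of the squared deviations *)
pose al l := N * `|prop_size n l - rho l|.
pose be j := `|weight_mean gamma k n j - 1|.
pose A j l := al l * (10 * Cm) + N * (be j * (3 * Cm)).
pose C j l := al l * 3 + N * (4 + be j * 2).
have bAC j l : bmf (fun w => A j l + C j l * Q w).
  by apply: bmfD; [exact: bmf_cst|exact: bmfZ].
have be_est := bmf_estimator Xs hKmeas KB gamma k n.
have bS : bmf (fun w => \sum_(c <- sample_index n) summand m rho gamma k n c (Xs c.1 c.2 w)).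
  apply: bmf_sum => c _.
  have mX : measurable_fun [set: T] (Xs c.1 c.2) by exact: measurable_funP.
  apply: (bmf_comp mX); apply: bmfZ; exact: (bmf_UV hlaw hm hKmeas KB).
apply: (@le_trans _ _ (\int[P]_w \sum_j \sum_l (A j l + C j l * Q w))).
  apply: bmf_mean_le.
  - by apply: bmf_norm; apply: bmfB => //; apply: bmfZ; apply: bmfB => //; exact: bmf_cst.
  - by apply: bmf_sum => j _; apply: bmf_sum => l _.
  - move=> w; rewrite (gmmd2_estimatorE Xs m)// sum_summand -/N.
    apply: le_trans (estimator_expansion (weight_mean gamma k n) m (dev n w) (wdev n w)
      (prop_size_itv n) N0 rho1) _.
    rewrite le_eqVlt; apply/orP; left; apply/eqP.
    apply: eq_bigr => j _; apply: eq_bigr => l _.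
    by rewrite /A /C /al /be /Q /Cm; ring.
rewrite bmf_mean_sum => [|j _]; last by apply: bmf_sum => l _.
apply: ler_sum => j _; rewrite bmf_mean_sum//; apply: ler_sum => l _.
rewrite mean_affine//.
have -> : N * `|prop_size n l - rho l| * (10 * Cm + 3 * q) +
    N * (4 * q + `|weight_mean gamma k n j - 1| * (3 * Cm + 2 * q)) = A j l + C j l * q.
  by rewrite /A /C /al /be; ring.
rewrite lerD2l ler_wpM2l ?mean_sqr_dev//.
by rewrite /C /al /be addr_ge0 ?mulr_ge0 ?addr_ge0 ?mulr_ge0.
Qed.

End remainder.

(** * Conclusion *)

Section weight_limits.
Context {R : realType}.
Variables (gamma : R) (k : forall r, 'I_r -> R -> R).
Arguments k : clear implicits.
Context {s : nat}.
Variables (n : nat -> 'I_s -> nat) (rho : 'I_s -> R).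
Hypothesis hn : forall j, n t j @[t --> \oo] --> \oo.
Hypothesis rho0 : forall j, 0 < rho j.
Hypothesis h2 : forall j, Num.sqrt (total_size (n t))%:R * (prop_size (n t) j - rho j)
  @[t --> \oo] --> (0 : R).
Hypothesis h3 : exists tau : R, 0 < tau /\ exists n0 : nat, forall r : nat,
  (n0 < r)%N -> r%:R * `|r%:R^-1 * (\sum_(i < r) k r i gamma) - 1| <= tau.

(** The bias of the mean weight is at most tau / n_j, which is o(1 / sqrt n). *)
Lemma sqrt_weight_mean_cvg j :
  Num.sqrt (total_size (n t))%:R * `|weight_mean gamma k (n t) j - 1|
    @[t --> \oo] --> (0 : R).
Proof.
have [tau [tau0 [n0 hn0]]] := h3.
have c : tau * (Num.sqrt (total_size (n t))%:R / (n t j)%:R) @[t --> \oo] --> (0 : R).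
  rewrite -[X in _ --> X](mulr0 tau); apply: cvgM; first exact: cvg_cst.
  exact: sqrt_ratio_cvg rho0 h2 j.
apply: (squeeze_cvgr _ (cvg_cst 0) c); near=> t.
have nj : (n0 < n t j)%N by near: t; exact: near_size_ge.
have nj0 : 0 < ((n t j)%:R : R) by rewrite ltr0n (leq_ltn_trans _ nj).
rewrite mulr_ge0 ?sqrtr_ge0//= mulrCA ler_wpM2l ?sqrtr_ge0//.
by rewrite ler_pdivlMr// mulrC; exact: hn0.
Unshelve. all: by end_near. Qed.

Lemma weight_mean_cvg j : weight_mean gamma k (n t) j @[t --> \oo] --> (1 : R).
Proof.
have [tau [tau0 [n0 hn0]]] := h3.
have c : tau * ((n t j)%:R : R)^-1 @[t --> \oo] --> (0 : R).
  rewrite -[X in _ --> X](mulr0 tau); apply: cvgM; first exact: cvg_cst.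
  exact: inv_size_cvg.
apply/cvgrPdist_le => e e0.
move/cvgrPdist_le/(_ e e0) : c => c; near=> t.
have nj : (n0 < n t j)%N by near: t; exact: near_size_ge.
have nj0 : 0 < ((n t j)%:R : R) by rewrite ltr0n (leq_ltn_trans _ nj).
have : `|0 - tau * ((n t j)%:R : R)^-1| <= e by near: t.
rewrite sub0r normrN ger0_norm ?mulr_ge0 ?invr_ge0 ?(ltW tau0)//; apply: le_trans.
by rewrite distrC ler_pdivlMr// mulrC; exact: hn0.
Unshelve. all: by end_near. Qed.

End weight_limits.

Theorem theorem1 (R : realType) (X : pmetricType R) (H : rkhs R X)
  (s : nat) (hs : (2 <= s)%N)
  (rho : 'I_s -> R) (hrho : forall j, 0 < rho j < 1)
  (hrho1 : \sum_j rho j = 1)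
  (gamma : R) (hgamma : 0 < gamma <= 1)
  (* distributions, samples, mean embeddings; the kernel is measurable *)
  (PP : 'I_s -> probability (borel X) R)
  (d : measure_display) (Omega : measurableType d) (P : probability Omega R)
  (Xs : 'I_s -> nat -> {RV P >-> borel X})
  (hlaw : forall (j : 'I_s) (i : nat) (A : set (borel X)), measurable A ->
     distribution P (Xs j i) A = PP j A)
  (hindep : independent_RVs (fun ji : 'I_s * nat => Xs ji.1 ji.2))
  (m : 'I_s -> H)
  (hm : forall j, is_mean_embedding P (Xs j 0%N) (m j))
  (hKmeas : measurable_fun [set: borel X * borel X]
     (fun z : borel X * borel X => rkhs_kernel H z.1 z.2))
  (* sample sizes *)
  (n : nat -> 'I_s -> nat)
  (hn : forall j, n t j @[t --> \oo] --> \oo)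
  (* weights *)
  (k : forall r : nat, 'I_r -> R -> R)
  (hk : forall (r : nat) (i : 'I_r) (g : R), 0 < g <= 1 -> 0 < k r i g)
  (* assumptions (1)-(5) *)
  (h1 : (ereal_sup [set (rkhs_kernel H z.1 z.2)%:E | z in [set: X * X]] < +oo)%E)
  (h2 : forall j, Num.sqrt (total_size (n t))%:R * (prop_size (n t) j - rho j)
     @[t --> \oo] --> (0 : R))
  (h3 : exists tau : R, 0 < tau /\ exists n0 : nat, forall r : nat,
     (n0 < r)%N ->
     r%:R * `|r%:R^-1 * (\sum_(i < r) k r i gamma) - 1| <= tau)
  (h4 : exists ck : R, forall (r : nat) (g : R), 0 < g <= 1 ->
     forall i : 'I_r, k r i g < ck)
  (k2 : R -> R)
  (h5 : forall g : R, 0 < g <= 1 ->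
     (r%:R^-1 * (\sum_(i < r) k r i g ^+ 2) @[r --> \oo] --> k2 g) /\
     1 < k2 g) :
  cvg_in_distribution P
    (fun t w => Num.sqrt (total_size (n t))%:R *
       (gmmd2_estimator H k gamma (n t) (fun j i => Xs j i w) - gmmd2 rho m))
    (centered_normal
       (asymptotic_variance P (fun j => Xs j 0%N : Omega -> X) rho m (k2 gamma))).
Proof.
have rho0 j : 0 < rho j by have /andP[] := hrho j.
have j0 : 'I_s by case: s hs {rho hrho hrho1 PP Xs hlaw hindep m hm n hn h2 rho0} => // s' _; exact: ord0.
have [B KB] : exists B, forall x y, rkhs_kernel H x y <= B.
  pose S := [set (rkhs_kernel H z.1 z.2)%:E | z in [set: X * X]].
  have ub x y : ((rkhs_kernel H x y)%:E <= ereal_sup S)%E.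
    by apply: ereal_sup_ubound; exists (x, y).
  exists (fine (ereal_sup S)) => x y; rewrite -lee_fin fineK//.
  by rewrite fin_numElt h1 andbT (lt_le_trans _ (ub x y))// ltNyr.
have [Ck kC] : exists C, forall r (i : 'I_r), `|k r i gamma| <= C.
  have [ck hck] := h4; exists ck => r i.
  by rewrite gtr0_norm ?hk// ltW// hck.
have [k2cvg k2gt1] := h5 gamma hgamma.
pose Xf (c : 'I_s * nat) := Xs c.1 c.2.
pose f t c := summand m rho gamma k (n t) c.
pose v t c := \int[P]_w (f t c (Xf c w) ^+ 2).
pose V t := \sum_(c <- sample_index (n t)) v t c.
pose W t w := \sum_(c <- sample_index (n t)) f t c (Xf c w).
have bUV := bmf_UV hlaw hm hKmeas KB rho.
have bf t c : bmf (f t c) by apply: bmfZ; exact: bUV.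
have bfX t c : bmf (fun w => f t c (Xf c w)).
  have mX : measurable_fun [set: Omega] (Xf c) by exact: measurable_funP.
  exact: (bmf_comp mX).
have Vcvg : V t @[t --> \oo] -->
    asymptotic_variance P (fun j => Xs j 0%N : Omega -> X) rho m (k2 gamma).
  rewrite (asymptotic_varianceE hlaw hm hKmeas KB).
  rewrite (_ : V = fun t => \sum_j 4 * ((total_size (n t))%:R / (n t j)%:R) *
    (varU Xs m rho j - 2 * weight_mean gamma k (n t) j * covUV Xs m rho j
      + weight_sqr_mean gamma k (n t) j * varV Xs m rho j)); last first.
    by apply/funext => t; rewrite -(sum_mean_summand_sqr hlaw hm hKmeas KB).
  apply: cvg_finite_sum => j; apply: cvgM.
    by apply: cvgM; [exact: cvg_cst|exact: total_ratio_cvg].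
  apply: cvgD; last first.
    apply: cvgM; last exact: cvg_cst.
    exact: (cvg_comp _ _ (hn j) k2cvg).
  apply: cvgB; first exact: cvg_cst.
  apply: cvgM; last exact: cvg_cst.
  rewrite -[X in _ --> X]mulr1; apply: cvgM; first exact: cvg_cst.
  exact: weight_mean_cvg.
apply: (@cvg_in_distribution_normal _ _ _ _ _ W V).
- move=> t; apply: bmfZ; apply: bmfB (bmf_cst _).
  exact: bmf_estimator hKmeas KB gamma k (n t).
- by move=> t; apply: bmf_sum => c _.
- by apply: (asymptotic_variance_ge0 hlaw hm hKmeas KB rho0); exact: ltW.
- exact: Vcvg.
- have [CU hCU] : {CU & forall j, forall x, `|Ufun rho m j x| <= CU j}.
    apply: (@choice _ _ (fun j c => forall x, `|Ufun rho m j x| <= c)) => j.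
    by have [_ [M UM]] := bmf_Ufun hlaw hm hKmeas KB rho j; exists M.
  have [CV hCV] : {CV & forall j, forall x, `|Vfun rho m j x| <= CV j}.
    apply: (@choice _ _ (fun j c => forall x, `|Vfun rho m j x| <= c)) => j.
    by have [_ [M VM]] := bmf_Vfun hlaw hm hKmeas KB rho j; exists M.
  pose Cw := Ck + `|Ck|.
  (* a bound on all summands at once, of order 1 / sqrt n *)
  pose M t := \sum_j Num.sqrt (total_size (n t))%:R / (n t j)%:R * (2 * (CU j + Cw * CV j)).
  apply: (@lindeberg_cvg _ _ _ _ _ P _ Xf f v M) => //.
  + by move=> t c; exact: (bf t c).1.
  + move=> t [j i] x; rewrite /f /summand/=.
    have CUV0 : 0 <= CU j + Cw * CV j.
      rewrite addr_ge0//; first exact: le_trans (hCU j x).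
      by rewrite mulr_ge0 ?(le_trans _ (hCV j x))// (le_trans _ (weight_bound kC 0 0)).
    rewrite /M (bigD1 j)//= -[leLHS]addr0 lerD//; last first.
      apply: sumr_ge0 => l _; rewrite mulr_ge0 ?divr_ge0 ?sqrtr_ge0// mulr_ge0//.
      rewrite addr_ge0//; first exact: le_trans (hCU l x).
      by rewrite mulr_ge0 ?(le_trans _ (hCV l x))// (le_trans _ (weight_bound kC 0 0)).
    rewrite normrM ger0_norm ?mulr_ge0 ?sqrtr_ge0 ?divr_ge0//.
    have -> (a b c : R) : a / b * (2 * c) = a * (2 / b) * c by ring.
    rewrite ler_wpM2l ?mulr_ge0 ?sqrtr_ge0 ?divr_ge0//.
    rewrite (le_trans (ler_normB _ _))// lerD ?hCU// normrM ler_pM//.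
    exact: weight_bound.
  + by move=> t c; exact: (mean_summand hlaw hm hKmeas KB).
  + by move=> t; exact: sample_index_uniq.
  + have E0 : \sum_(j < s) 0 * (2 * (CU j + Cw * CV j)) = 0.
      by rewrite big1// => j _; rewrite mul0r.
    rewrite -[X in _ --> X]E0; apply: cvg_finite_sum => j; apply: cvgM; last exact: cvg_cst.
    exact: sqrt_ratio_cvg.
  + exact: Vcvg.
- pose q t := sqr_dev_bound m B Ck (n t).
  pose Cm := \sum_l rkhs_dot H (m l) (m l).
  pose N t : R := Num.sqrt (total_size (n t))%:R.
  (* the bound of [mean_remainder], written so that each term has a factor with limit 0 *)
  pose b t := \sum_j \sum_l (N t * `|prop_size (n t) l - rho l| * (10 * Cm + 3 * q t)
     + (4 * (N t * q t) + N t * `|weight_mean gamma k (n t) j - 1| * (3 * Cm + 2 * q t))).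
  have E0 : \sum_(j < s) (1 + Ck ^+ 2) * (2 * (B + rkhs_dot H (m j) (m j))) * 0 = 0.
    by rewrite big1// => j _; rewrite mulr0.
  have q0 : q t @[t --> \oo] --> (0 : R).
    rewrite -[X in _ --> X]E0.
    apply: cvg_finite_sum => j; apply: cvgM; first exact: cvg_cst.
    exact: inv_size_cvg.
  have Nq0 : N t * q t @[t --> \oo] --> (0 : R).
    rewrite (_ : (fun t => _) = fun t => \sum_j (1 + Ck ^+ 2) *
      (2 * (B + rkhs_dot H (m j) (m j))) * (N t / (n t j)%:R)); last first.
      by apply/funext => t; rewrite mulr_sumr; apply: eq_bigr => j _; rewrite mulrCA.
    rewrite -[X in _ --> X]E0.
    apply: cvg_finite_sum => j; apply: cvgM; first exact: cvg_cst.
    exact: sqrt_ratio_cvg.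
  have b0 : b t @[t --> \oo] --> (0 : R).
    have E1 : \sum_(j < s) \sum_(l < s) (0 * (10 * Cm + 3 * 0)
        + (4 * 0 + 0 * (3 * Cm + 2 * 0))) = 0.
      by rewrite big1// => j _; rewrite big1// => l _; rewrite !mul0r mulr0 !addr0.
    rewrite -[X in _ --> X]E1; apply: cvg_finite_sum => j; apply: cvg_finite_sum => l; apply: cvgD.
      apply: cvgM.
        rewrite (_ : (fun t => _) = fun t => `|N t * (prop_size (n t) l - rho l)|).
          by apply/norm_cvg0P; exact: h2.
        by apply/funext => t; rewrite normrM ger0_norm ?sqrtr_ge0.
      by apply: cvgD; [exact: cvg_cst|apply: cvgM q0; exact: cvg_cst].
    apply: cvgD; first by apply: cvgM Nq0; exact: cvg_cst.
    apply: cvgM; first exact: sqrt_weight_mean_cvg rho0 h2 h3 j.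
    by apply: cvgD; [exact: cvg_cst|apply: cvgM q0; exact: cvg_cst].
  apply: (squeeze_cvgr _ (cvg_cst 0) b0); near=> t.
  have nt0 j : (0 < n t j)%N.
    move: j; near: t; apply: filter_forall => j; exact: near_size_ge.
  rewrite Rintegral_ge0//=.
  apply: le_trans (mean_remainder hlaw hindep hm hKmeas KB kC nt0 hrho1) _.
  rewrite le_eqVlt; apply/orP; left; apply/eqP.
  apply: eq_bigr => j _; apply: eq_bigr => l _.
  by rewrite /N /q /Cm; ring.
Unshelve. all: by end_near. Qed.
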